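(* Let $n\geq 3$, let $H$ be any graph, and let $S=K[V(C_n\odot H)]$. Then $$\operatorname{reg}(S/I(C_n\odot H))=\begin{cases}\lceil\frac{n-1}{2}\rceil, & \text{if } H \text{ is a null graph};\\ n\cdot\operatorname{reg}(K[V(H)]/I(H)), & \text{otherwise}.\end{cases}$$
   Context: $K$ is a field. All graphs are finite, simple, have nonempty vertex set, and may have isolated vertices. Vertices of a graph $G$ are identified with the variables of the standard graded polynomial ring $K[V(G)]$. A null graph is a graph with no edges. Edge ideal convention: $I(G)\subset K[V(G)]$ is the ideal generated by all products $x_ix_j$ with $\{x_i,x_j\}\in E(G)$ together with all variables $x_k$ with $x_k$ an isolated vertex of $G$. (Thus $K[V(H)]/I(H)\cong K[V(H')]/I(H')$, where $H'$ is the induced subgraph of $H$ on the non-isolated vertices.) The corona product $X\odot H$ is the graph obtained from one copy of $X$ and $|V(X)|$ disjoint copies of $H$, namely $H_1,\dots,H_{|V(X)|}$, by joining the $i$-th vertex of $X$ to every vertex of $H_i$. It has no isolated vertices, so $I(X\odot H)$ is the usual edge ideal. $C_n$ is the cycle on $n$ vertices. $\operatorname{reg}(A)=\max\{j-i:\beta_{i,j}(A)\neq0\}$ is the Castelnuovo–Mumford regularity, where $\beta_{i,j}(A)$ are the graded Betti numbers of the finitely generated graded module $A$ over the corresponding polynomial ring. *)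

(* Defs.v *)
From HB Require Import structures.
From mathcomp Require Import all_boot all_order all_algebra.
From mathcomp Require Import mpoly.
From Stdlib Require Import ClassicalEpsilon.

Set Implicit Arguments.
Unset Strict Implicit.
Unset Printing Implicit Defensive.

Import Order.TTheory GRing.Theory Num.Theory.
Local Open Scope ring_scope.

Record sgraph := SGraph {
  vertex :> finType;
  adj : rel vertex;
  adj_sym : ssrbool.symmetric adj;
  adj_irrefl : irreflexive adj }.

Definition null_graph (G : sgraph) : bool :=
  [forall x : G, forall y : G, ~~ adj x y].

Definition isolated (G : sgraph) (x : G) : bool := [forall y : G, ~~ adj x y].

(* The conjunct [i != j] only matters for [n = 1], where it removes a loop. *)
Definition cycle_adj n : rel 'I_n :=
  fun i j => (i != j) && ((j == ordS i) || (i == ordS j)).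

Fact cycle_adj_sym n : ssrbool.symmetric (@cycle_adj n).
Proof. by move=> i j; rewrite /cycle_adj eq_sym orbC. Qed.

Fact cycle_adj_irrefl n : irreflexive (@cycle_adj n).
Proof. by move=> i; rewrite /cycle_adj eqxx. Qed.

Definition cycle_graph n : sgraph :=
  SGraph (@cycle_adj_sym n) (@cycle_adj_irrefl n).

(* [inr (x, h)] is the vertex [h] of the copy of [H] attached to [x]. *)
Definition corona_adj (X H : sgraph) : rel (X + X * H)%type := fun u v =>
  match u, v with
  | inl x, inl y => adj x y
  | inl x, inr (y, _) => x == y
  | inr (x, _), inl y => x == y
  | inr (x, h), inr (y, k) => (x == y) && adj h k
  end.

Fact corona_adj_sym (X H : sgraph) : ssrbool.symmetric (@corona_adj X H).
Proof.
by move=> [x|[x h]] [y|[y k]] //=; rewrite 1?adj_sym // 1?eq_sym // adj_sym.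
Qed.

Fact corona_adj_irrefl (X H : sgraph) : irreflexive (@corona_adj X H).
Proof. by move=> [x|[x h]] /=; rewrite adj_irrefl ?andbF. Qed.

Definition corona (X H : sgraph) : sgraph :=
  SGraph (@corona_adj_sym X H) (@corona_adj_irrefl X H).

Section EdgeIdeal.

Variables (K : fieldType) (G : sgraph).

Definition vvar (x : G) : {mpoly K[#|G|]} := 'X_(enum_rank x).

Definition edge_gen (p : {mpoly K[#|G|]}) : Prop :=
  (exists x y : G, adj x y /\ p = vvar x * vvar y) \/
  (exists x : G, isolated x /\ p = vvar x).

End EdgeIdeal.

Definition ideal_generated (R : comNzRingType) (gen : R -> Prop) (p : R) : Prop :=
  exists s : seq (R * R),
    (forall c, c \in s -> gen c.2) /\ p = \sum_(c <- s) c.1 * c.2.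

Definition edge_ideal (K : fieldType) (G : sgraph) : {mpoly K[#|G|]} -> Prop :=
  ideal_generated (@edge_gen K G).

Section Resolution.

Variables (K : fieldType) (n : nat).

(* A sequence of graded free modules F_i = \bigoplus_a S(- shift i a), with
   S = K[x_1, ..., x_n] and [a] ranging over ['I_(rank i)]. Elements of F_i are
   row vectors, and the maps F_(i+1) -> F_i act by right multiplication.  The
   column [aug] gives representatives in S of the images in S / I of the
   generators of F_0.  Shifts are naturals, which is no restriction for the
   minimal resolution of a quotient of S. *)
Record free_complex := FreeComplex {
  rank : nat -> nat;
  shift : forall i, 'I_(rank i) -> nat;
  diff : forall i, 'M[{mpoly K[n]}]_(rank i.+1, rank i);
  aug : 'cV[{mpoly K[n]}]_(rank 0) }.

Definition zero_complex : free_complex :=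
  @FreeComplex (fun=> 0%N) (fun _ _ => 0%N) (fun=> 0) 0.

Definition graded_complex (F : free_complex) : Prop :=
  (forall a, aug F a 0 \is (shift a).-homog) /\
  (forall i (a : 'I_(rank F i.+1)) (b : 'I_(rank F i)) (m : 'X_{1..n}),
     m \in msupp (diff F i a b) -> (shift b + mdeg m)%N = shift a).

(* Exactness of ... -> F_1 -> F_0 -> S / I -> 0; a polynomial vanishes in S / I
   iff it satisfies [I]. *)
Definition resolves (F : free_complex) (I : {mpoly K[n]} -> Prop) : Prop :=
  [/\ forall p : {mpoly K[n]}, exists v : 'rV_(rank F 0),
        I (p - (v *m aug F) 0 0),
      forall v : 'rV_(rank F 0),
        I ((v *m aug F) 0 0) <-> exists w, v = w *m diff F 0
    & forall i (v : 'rV_(rank F i.+1)),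
        v *m diff F i = 0 <-> exists w, v = w *m diff F i.+1].

(* The image of F_(i+1) lies in (x_1, ..., x_n) F_i. *)
Definition minimal_complex (F : free_complex) : Prop :=
  forall i a b, (diff F i a b)@_0%MM = 0.

Definition minimal_graded_resolution
    (I : {mpoly K[n]} -> Prop) (F : free_complex) : Prop :=
  [/\ graded_complex F, resolves F I & minimal_complex F].

(* The minimal graded free resolution of S / I exists for every homogeneous
   ideal I and is unique up to isomorphism, so the numbers below do not depend
   on the choice. *)
Definition min_res (I : {mpoly K[n]} -> Prop) : free_complex :=
  epsilon (inhabits zero_complex) (minimal_graded_resolution I).

Definition graded_betti (I : {mpoly K[n]} -> Prop) (i j : nat) : nat :=
  #|[set a : 'I_(rank (min_res I) i) | shift a == j]|.

Definition is_regularity (I : {mpoly K[n]} -> Prop) (r : int) : Prop :=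
  (exists i j, graded_betti I i j <> 0%N /\ r = j%:Z - i%:Z) /\
  (forall i j, graded_betti I i j <> 0%N -> j%:Z - i%:Z <= r).

(* reg (S / I), for a proper homogeneous ideal I (otherwise S / I = 0 and the
   maximum is over the empty set). *)
Definition regularity (I : {mpoly K[n]} -> Prop) : int :=
  epsilon (inhabits (0 : int)) (is_regularity I).

End Resolution.

(* Main.v *)
Require Import Defs.
From HB Require Import structures.
From mathcomp Require Import all_boot all_order all_algebra.
From mathcomp Require Import mpoly zify ring.
From Stdlib Require Import Classical ClassicalEpsilon.

Set Implicit Arguments.
Unset Strict Implicit.
Unset Printing Implicit Defensive.

Import Order.TTheory GRing.Theory Num.Theory.
Local Open Scope ring_scope.

(** The regularity is defined through a chosen minimal resolution, which gives no direct
    access to it. The proof replaces it by the homology of explicit finite complexes over [K].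

    Let an ideal be generated by the squarefree monomials [g e], [e \in E]. Its Taylor complex
    has a basis element for each set [T] of generators, of multidegree [cov g T], the union of
    the [g e]. It is a graded free resolution, because in each multidegree it is the complex of
    a full simplex ([taylor_resolves]). A minimal graded resolution exists
    ([resolution_minimal], resting on Dickson's lemma) and is homotopy equivalent to it
    ([minimal_shift_tor]). Hence [beta_(i, j)] is non-zero if and only if, for some set [s] of
    [j] vertices, the part spanned by the [T] with [cov g T = s] of the Taylor complex modulo
    the variables, called the strand of [s], is not exact in degree [i]
    ([graded_betti_exact]). The regularity is at most [r] when all strands with
    [r + i < #|s|] are exact ([reg_le]).

    Two properties of strands carry the computation. First, a strand of [I] at a set
    containing the vertex [x] is the quotient of a strand of [I : x] by one of the generators
    free of [x]; this gives [reg S/I <= max (reg S/(I, x)) (reg S/(I : x) + 1)]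
    ([vertex_step]). For a graph it reads
    [reg G <= max (reg (G - x)) (reg (G - N[x]) + 1)] ([avoid_step]). Secondly, for families
    of monomials in disjoint sets of variables, strands are tensor products, so the
    regularities add up ([kunneth_reg_le], [kunneth_not_exact]).

    In the corona of [X] and [H], deleting a vertex [x] of [X] with its neighbours also deletes
    the copy of [H] at [x]. If [H] has no edges, repeating the step bounds the regularity by the
    independence number of [X], and the leaves at an independent set form an induced
    matching, which shows that the bound is attained. If [H] has an edge, then its regularity
    [r] is at least 1, so the loss of a copy of [H] outweighs the increment 1; what remains at
    the end are disjoint copies of [H], and the bound is [#|X| * r]. It is attained, because a
    strand supported on the copies of [H] does not see the vertices of [X]. These two cases
    are [regularity_corona]; the independence number of the cycle is [n./2]
    ([alpha_cycle]). *)

(** * Signed simplices *)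

(** The signs of a simplicial boundary are usually taken from a linear order of the
    vertices. They only use the comparisons of pairs, so any tournament serves. *)
Definition tournament (I : finType) (lt : rel I) :=
  forall e e', e != e' -> lt e e' = ~~ lt e' e.

Section Simplex.
Variables (R : comNzRingType) (I : finType) (lt : rel I).
Hypothesis lt_tour : tournament lt.

Definition sgn (e : I) (T : {set I}) : R := \prod_(e' in T) (-1) ^+ lt e' e.

Lemma sgnU e e' (T : {set I}) : e' \notin T -> sgn e (e' |: T) = (-1) ^+ lt e' e * sgn e T.
Proof. by move=> e'T; rewrite /sgn big_setU1. Qed.

Lemma sgn_sq e T : sgn e T * sgn e T = 1.
Proof.
rewrite /sgn -big_split /= big1 // => e' _.
by rewrite -expr2 sqrr_sign.
Qed.

Lemma sgn_anti e e' (T : {set I}) : e != e' -> e \notin T -> e' \notin T ->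
  sgn e (e' |: T) * sgn e' T = - (sgn e' (e |: T) * sgn e T).
Proof.
move=> ee' eT e'T; rewrite !sgnU // [lt e e']lt_tour //.
rewrite -!mulrA [sgn e T * _]mulrC.
by case: (lt e' e) => /=; rewrite ?expr1 ?expr0 ?mulN1r ?mul1r ?opprK.
Qed.

Lemma sgn_anti2 e e' (T : {set I}) : e != e' -> e \notin T -> e' \notin T ->
  sgn e (e' |: T) * sgn e' (e |: T) = - (sgn e T * sgn e' T).
Proof.
move=> ee' eT e'T; rewrite !sgnU // [lt e e']lt_tour // mulrACA.
by case: (lt e' e) => /=; rewrite ?expr1 ?expr0 ?mulN1r ?mul1r ?mulr1 ?mulN1r.
Qed.

(** Chains are given by their coefficients, so the boundary of [f] has at [T] the
    contributions of the sets with one more element than [T]. *)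
Definition bnd (A : {set I}) (f : {set I} -> R) (T : {set I}) : R :=
  \sum_(e in A :\: T) sgn e T * f (e |: T).

Lemma eq_bnd A f f' T : (forall e, e \in A :\: T -> f (e |: T) = f' (e |: T)) ->
  bnd A f T = bnd A f' T.
Proof. by move=> ff'; apply: eq_bigr => e eA; rewrite ff'. Qed.

Lemma bndB A f f' T :
  bnd A (fun T => f T - f' T) T = bnd A f T - bnd A f' T.
Proof. by rewrite /bnd -sumrB; apply: eq_bigr => e _; rewrite mulrBr. Qed.

(** The terms of the ordered pairs [(e, e')] and [(e', e)] cancel. Splitting the pairs
    by [lt] keeps the argument valid in characteristic 2, where a sum equal to its
    opposite need not vanish. *)
Lemma bnd_bnd A f T : bnd A (bnd A f) T = 0.
Proof.
rewrite /bnd.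
pose F e e' := sgn e T * (sgn e' (e |: T) * f (e' |: (e |: T))).
transitivity (\sum_(e in A :\: T) \sum_(e' in A :\: T | e' != e) F e e').
  apply: eq_bigr => e _; rewrite mulr_sumr; apply: eq_bigl => e'.
  by rewrite !inE negb_or -andbA [RHS]andbC.
transitivity (\sum_(e in A :\: T) \sum_(e' in A :\: T | (e' != e) && lt e e') F e e'
  + \sum_(e in A :\: T) \sum_(e' in A :\: T | (e' != e) && ~~ lt e e') F e e').
  rewrite -big_split /=; apply: eq_bigr => e _.
  rewrite (bigID (fun e' => lt e e')) /=; congr (_ + _);
    by apply: eq_bigl => e'; rewrite -andbA.
rewrite [X in _ + X](exchange_big_dep (fun e => e \in A :\: T)) /=; last by move=> ? ? _ /andP[].
rewrite -big_split /= big1 // => e eA.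
rewrite [X in _ + X](eq_bigl (fun e' => (e' \in A :\: T) && ((e' != e) && lt e e'))); last first.
  move=> e'; rewrite eA andTb eq_sym; case: eqP => //= /eqP ne.
  by rewrite [in RHS]lt_tour // eq_sym.
rewrite -big_split /= big1 // => e' /andP[e'A /andP[ne _]].
move: eA e'A; rewrite !inE => /andP[eT _] /andP[e'T _].
rewrite /F setUCA !mulrA -mulrDl [sgn e T * _]mulrC [sgn e' T * _]mulrC.
by rewrite sgn_anti // addNr mul0r.
Qed.

Definition cone (e0 : I) (f : {set I} -> R) (T : {set I}) : R :=
  if e0 \in T then sgn e0 (T :\ e0) * f (T :\ e0) else 0.

(** The full simplex on [A] is a cone with apex any [e0 \in A], hence contractible. *)
Lemma bnd_cone (A : {set I}) e0 f T : e0 \in A ->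
  bnd A (cone e0 f) T + cone e0 (bnd A f) T = f T.
Proof.
move=> e0A; rewrite /cone; case: ifPn => [e0T|e0T]; last first.
  rewrite addr0 /bnd (bigD1 e0) /=; last by rewrite !inE e0T.
  rewrite setU11 setU1K // mulrA sgn_sq mul1r.
  rewrite big1 ?addr0 // => e /andP[_ ne].
  by rewrite !inE eq_sym (negPf ne) (negPf e0T) mulr0.
have {e0T} [T' e0T' ->] : exists2 T' : {set I}, e0 \notin T' & T = e0 |: T'.
  by exists (T :\ e0); rewrite ?setD1K // !inE eqxx.
rewrite setU1K //.
rewrite /bnd [X in _ + sgn e0 T' * X](bigD1 e0) /=; last first.
  by rewrite in_setD e0T' e0A.
rewrite mulrDr mulrA sgn_sq mul1r addrCA -[RHS]addr0; congr (_ + _).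
rewrite mulr_sumr [X in _ + X](eq_bigl (fun e => e \in A :\: (e0 |: T'))); last first.
  by move=> e; rewrite !in_setD in_setU1 negb_or andbC andbA.
rewrite -big_split /= big1 // => e; rewrite in_setD in_setU1 negb_or => /andP[/andP[ne eT'] _].
rewrite setUCA in_setU1 eqxx /= setU1K; last by rewrite in_setU1 negb_or eq_sym ne.
by rewrite !mulrA -mulrDl sgn_anti2 // [sgn e0 T' * _]mulrC addNr mul0r.
Qed.

End Simplex.

(** * Strands of a family of squarefree monomials *)

Section Strands.
Variables (K : fieldType) (V I : finType) (lt : rel I).
Hypothesis lt_tour : tournament lt.
Implicit Types (g : I -> {set V}) (E T : {set I}) (s : {set V}).

Definition cov g T : {set V} := \bigcup_(e in T) g e.

Definition inside g E s : {set I} := [set e in E | g e \subset s].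

(** The Taylor complex of the monomials [g e], reduced modulo the variables, is the
    sum over [s] of the complexes spanned by the [T] with [cov g T = s], because the
    coefficient of [T] in the boundary of [e |: T] is a constant only if both cover
    the same set. This is exactness of the summand of [s] in degree [i]. Only the
    values of [f] and [u] at such [T] enter, so no condition is put on the others. *)
Definition exact_at g E (s : {set V}) (i : nat) : Prop :=
  forall f : {set I} -> K,
    (forall T, T \subset inside g E s -> #|T|.+1 = i -> cov g T = s ->
       bnd lt (inside g E s) f T = 0) ->
  exists u : {set I} -> K,
    forall T, T \subset inside g E s -> #|T| = i -> cov g T = s ->
      bnd lt (inside g E s) u T = f T.

(** The strand of [s] in degree [i] contributes to the Betti number [beta_(i, #|s|)],
    so this bounds the regularity by [r]. *)
Definition reg_le g E r : Prop := forall s i, (r + i < #|s|)%N -> exact_at g E s i.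

Lemma covU1 g e T : cov g (e |: T) = g e :|: cov g T.
Proof. by rewrite /cov bigcup_setU big_set1. Qed.

Lemma cov_sub g E T : T \subset E -> cov g T \subset cov g E.
Proof. by move=> /subsetP TE; apply/bigcupsP => e eT; apply: bigcup_sup; apply: TE. Qed.

Lemma cov_inside g E s T : T \subset inside g E s -> cov g T \subset s.
Proof.
by move=> /subsetP TA; apply/bigcupsP => e /TA; rewrite inE => /andP[].
Qed.

Lemma cov_insideU g E s e T : e \in inside g E s -> cov g T = s -> cov g (e |: T) = s.
Proof.
by rewrite inE covU1 => /andP[_ es] ->; apply/setUidPr.
Qed.

Lemma eq_exact_at g g' E E' s s' i : inside g E s = inside g' E' s' ->
  (forall T, T \subset inside g E s -> (cov g T == s) = (cov g' T == s')) ->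
  exact_at g E s i -> exact_at g' E' s' i.
Proof.
rewrite /exact_at => <- covE ex f cyc.
have [T TA Ti /eqP cT|u uP] := ex f.
  by apply: cyc => //; apply/eqP; rewrite -covE.
by exists u => T TA Ti /eqP cT; apply: uP => //; apply/eqP; rewrite covE.
Qed.

(** The strand of [s] is zero unless the generators inside [s] cover [s]. *)
Lemma exact_no_cover g E s i : cov g (inside g E s) != s -> exact_at g E s i.
Proof.
move=> cA f _; exists f => T TA _ cT; case/negP: cA.
by rewrite eqEsubset (cov_inside (subxx _)) // -{1}cT cov_sub.
Qed.

Lemma eq_reg_le g g' E r : {in E, g =1 g'} -> reg_le g E r -> reg_le g' E r.
Proof.
move=> gg' rE s i /rE; apply: eq_exact_at => [|T /subsetP TA].
  by apply/setP => e; rewrite !inE; case eE: (e \in E); rewrite //= gg'.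
congr (_ == _); apply: eq_bigr => e /TA; rewrite inE => /andP[eE _]; exact: gg'.
Qed.

Lemma reg_leW g E r r' : (r <= r')%N -> reg_le g E r -> reg_le g E r'.
Proof.
by move=> rr' rE s i ri; apply: rE; apply: leq_ltn_trans ri; rewrite leq_add2r.
Qed.

(** The unit ideal has no homology: an element [e0] with empty [g e0] can be added to
    or removed from [T] without changing [cov g T], so the cone with apex [e0] stays
    in the strand. *)
Lemma exact_cone g E s i e0 : e0 \in E -> g e0 = set0 -> exact_at g E s i.
Proof.
move=> e0E g0 f cyc; exists (cone lt e0 f) => T TA Ti cT.
have e0A : e0 \in inside g E s by rewrite inE e0E g0 sub0set.
rewrite -[RHS](bnd_cone lt_tour f T e0A) /cone; case: ifPn => e0T; last by rewrite addr0.
rewrite cyc ?mulr0 ?addr0 //.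
- by apply: subset_trans TA; apply: subsetDl.
- by rewrite -Ti (cardsD1 e0 T) e0T.
- by move: cT; rewrite -{1}(setD1K e0T) covU1 g0 set0U.
Qed.

(** The inequality [reg S/I <= max (reg S/(I, x)) (reg S/(I : x) + 1)] for a
    squarefree monomial ideal. The ideal [I : x] is generated by the [g e :\ x]. Let
    [s] contain [x]. The sets [T] for which these generators cover exactly [s :\ x]
    are those with [cov g T = s] and those made of generators free of [x] with
    [cov g T = s :\ x]. The latter span a subcomplex, so the strand of [I] at [s] is
    the quotient of the strand of [I : x] at [s :\ x] by that of the generators free
    of [x]. Exactness passes to the quotient with the usual shift. *)
Lemma vertex_step g E x r :
  reg_le g [set e in E | x \notin g e] r ->
  (forall s i, (r + i <= #|s|)%N -> exact_at (fun e => g e :\ x) E s i) ->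
  reg_le g E r.
Proof.
set E0 := [set e in E | _]; set g' := fun e => _ => rE0 rE' s i ri.
case: (boolP (x \in s)) => xs; last first.
  apply: eq_exact_at (rE0 s i ri) => //; apply/setP => e; rewrite !inE.
  case es: (g e \subset s); rewrite ?andbF // !andbT.
  by rewrite (contra _ xs) ?andbT //; apply: (subsetP es).
have cs : #|s| = #|s :\ x|.+1 by rewrite (cardsD1 x) xs.
set A := inside g E s.
have A'E : inside g' E (s :\ x) = A.
  apply/setP => e; rewrite !inE /g'; case: (e \in E) => //=.
  apply/subsetP/subsetP => es y; last first.
    by rewrite !inE => /andP[-> /es].
  by move=> yg; case: (eqVneq y x) => [->//|yx]; move: (es y); rewrite !inE yx /= => ->.
pose A0 := inside g E0 (s :\ x).
have A0P e : (e \in A0) = (e \in A) && (x \notin g e).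
  rewrite !inE subsetD1 -!andbA; case: (e \in E) => //=.
  by case: (x \notin _); rewrite ?andbF ?andbT.
have A0A : A0 \subset A by apply/subsetP => e; rewrite A0P => /andP[].
have cov'E T : cov g' T = cov g T :\ x.
  apply/setP => y; rewrite !inE; apply/bigcupP/andP => [[e eT]|[yx /bigcupP[e eT ye]]].
    by rewrite !inE => /andP[yx ye]; split=> //; apply/bigcupP; exists e.
  by exists e; rewrite // !inE yx.
have cov_x T : T \subset A -> (x \notin cov g T) = (T \subset A0).
  move=> /subsetP TA; apply/idP/idP => [xT|/subsetP TA0].
    apply/subsetP => e eT; rewrite A0P TA //=; apply: contra xT => xe.
    by apply/bigcupP; exists e.
  by apply/bigcupP => -[e /TA0]; rewrite A0P => /andP[_ /negP].
have cov2 T : cov g' T = s :\ x -> T \subset A -> cov g T = s \/ (cov g T = s :\ x /\ T \subset A0).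
  rewrite cov'E => cT TA; case: (boolP (x \in cov g T)) => xT.
    by left; rewrite -(setD1K xT) cT setD1K.
  right; split; last by rewrite -cov_x.
  by rewrite -cT; apply/setP => y; rewrite !inE; case: eqP => // ->; rewrite (negPf xT).
move=> f cyc.
case: i ri cyc => [|i] ri cyc.
  exists f => T _ /cards0_eq -> cT; move: xs; rewrite -cT /cov big_set0 inE //.
(* [f1] lifts the cycle [f] to the strand of [I : x]; its boundary lies in the
   subcomplex and is a cycle there. *)
pose f1 T := if cov g T == s then f T else 0.
have f1s T : cov g T = s -> forall e, e \in A -> f1 (e |: T) = f (e |: T).
  by move=> cT e eA; rewrite /f1 (cov_insideU eA cT) eqxx.
have df1 T : T \subset A -> #|T| = i -> cov g T = s -> bnd lt A f1 T = 0.
  move=> TA Ti cT; rewrite -[RHS](cyc T) ?Ti //; apply: eq_bnd => e.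
  by rewrite inE => /andP[_ eA]; apply: f1s.
have ri0 : (r + i < #|s :\ x|)%N by move: ri; rewrite cs addnS ltnS.
have [|w wP] := rE0 (s :\ x) i ri0 (bnd lt A f1).
  rewrite -/A0 => T TA0 Ti cT; rewrite -[RHS](bnd_bnd lt_tour A f1 T).
  move: df1; move: (bnd lt A f1) => F dF; rewrite /bnd.
  rewrite [RHS](bigID (fun e => x \notin g e)) /= [X in _ + X]big1 ?addr0.
    apply: eq_bigl => e; rewrite !inE -!andbA subsetD1.
    by do ![case: (_ \in _) => //=]; rewrite ?andbF ?andbT.
  move=> e; rewrite negbK inE => /andP[/andP[eT eA] xe].
  rewrite dF ?mulr0 //.
  + by rewrite subUset sub1set eA (subset_trans TA0 A0A).
  + by rewrite cardsU1 eT.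
  + rewrite covU1 cT; apply/setP => y; rewrite !inE; case: eqP => [->|_]; first by rewrite xe.
    by case yg : (y \in g e) => //=; move: eA; rewrite inE => /andP[_ /subsetP ->].
(* Correcting the lift by the filling [w] of that boundary gives a cycle of the strand
   of [I : x]. *)
pose w1 T := if T \subset A0 then w T else 0.
have dw1 T : T \subset A -> cov g T = s -> bnd lt A w1 T = 0.
  move=> TA cT; rewrite /bnd big1 // => e _.
  by rewrite /w1 subUset -[T \subset A0]cov_x // cT xs andbF mulr0.
have dw0 T : T \subset A0 -> bnd lt A w1 T = bnd lt A0 w T.
  move=> TA0; rewrite /bnd [LHS](bigID (fun e => e \in A0)) /= [X in _ + X]big1 ?addr0.
    transitivity (\sum_(e in A0 :\: T) sgn K lt e T * w1 (e |: T)).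
      apply: eq_bigl => e; rewrite !in_setD [RHS]andbC; case eA0: (e \in A0); rewrite ?andbF //.
      by rewrite (subsetP A0A) // !andbT.
    by apply: eq_bigr => e; rewrite inE => /andP[_ eA0]; rewrite /w1 subUset sub1set eA0 TA0.
  by move=> e /andP[_ eA0]; rewrite /w1 subUset sub1set (negPf eA0) mulr0.
have ri1 : (r + i.+1 <= #|s :\ x|)%N by rewrite addnS.
have [|u uP] := rE' (s :\ x) i.+1 ri1 (fun T => f1 T - w1 T).
  rewrite A'E => T TA [Ti] cT; rewrite bndB.
  case: (cov2 T cT TA) => [cs'|[cs' TA0]]; first by rewrite df1 ?dw1 ?subr0.
  by rewrite dw0 // wP // subrr.
exists u => T TA Ti cT; move: (uP T); rewrite A'E => -> //; last by rewrite cov'E cT.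
by rewrite /f1 /w1 cT eqxx -cov_x // cT xs subr0.
Qed.

(** Once the variable [y] is a generator, the other generators containing [y] are
    redundant. Here [I : y] is the unit ideal, so the vertex step has no second term. *)
Lemma reg_le_single g E e0 y r : e0 \in E -> g e0 = [set y] ->
  reg_le g [set e in E | y \notin g e] r -> reg_le g E r.
Proof.
move=> e0E g0 rE; apply: vertex_step rE _ => s i _.
by apply: exact_cone e0E _; rewrite g0 setDv.
Qed.

Lemma reg_le_singles g E (Y : {set V}) r :
  (forall y, y \in Y -> (exists2 e0, e0 \in E & g e0 = [set y]) \/
     (forall e, e \in E -> y \notin g e)) ->
  reg_le g [set e in E | [disjoint g e & Y]] r -> reg_le g E r.
Proof.
have [m] := ubnP #|Y|; elim: m Y E => // m IH Y E Ym YE rE.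
case: (set_0Vmem Y) => [Y0|[y yY]].
  by move: rE; rewrite Y0; congr reg_le; apply/setP => e; rewrite inE -setI_eq0 setI0 eqxx andbT.
have YmD : (#|Y :\ y| < m)%N by move: Ym; rewrite (cardsD1 y) yY.
have disjE e : [disjoint g e & Y] = (y \notin g e) && [disjoint g e & Y :\ y].
  by rewrite -{1}(setD1K yY) -!setI_eq0 setIUr setU_eq0 setI_eq0 disjoint_sym disjoints1.
have rD : reg_le g [set e in E | y \notin g e] r.
  apply: (IH (Y :\ y)) => // [z|].
    rewrite inE => /andP[zy /YE[[e0 e0E g0]|zE]]; [left|right].
      by exists e0; rewrite // !inE e0E g0 inE eq_sym -in_set1.
    by move=> e; rewrite inE => /andP[/zE].
  by move: rE; congr reg_le; apply/setP => e; rewrite !inE disjE andbA.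
case: (YE y yY) => [[e0 e0E g0]|yE]; first exact: reg_le_single e0E g0 rD.
by move: rD; congr reg_le; apply/setP => e; rewrite inE; case eE: (e \in E); rewrite //= yE.
Qed.

(** A strand consisting of a single set [A] has a cycle in degree [#|A|] and nothing
    to bound it. *)
Lemma not_exact_full g E s : let A := inside g E s in cov g A = s ->
  (forall T, T \subset A -> cov g T = s -> T = A) -> ~ exact_at g E s #|A|.
Proof.
move=> A cA full /(_ (fun=> 1)) [T|u]; rewrite -/A.
  by move=> TA Ti cT; move: Ti; rewrite (full T) // => /eqP; rewrite eqn_leq ltnn.
move/(_ A (subxx _) erefl cA)/eqP; rewrite /bnd setDv big_set0 eq_sym.
by rewrite (negPf (oner_neq0 K)).
Qed.

End Strands.

(** * Tensor products of complexes over a field *)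

Section MatrixComplex.
Variable (K : fieldType).

Lemma mulmx_col m n p (A : 'M[K]_(m, n)) (B : 'M[K]_(n, p)) j :
  A *m col j B = col j (A *m B).
Proof. by rewrite !colE mulmxA. Qed.

Section One.
Variables (m : nat) (deg : 'I_m -> nat) (D : 'M[K]_m).

Definition lowering := forall a b, D a b != 0 -> deg b = (deg a).+1.

Definition exact_mx i := forall f : 'cV[K]_m,
  (forall a, deg a != i -> f a 0 = 0) -> D *m f = 0 -> exists u, D *m u = f.

Hypotheses (D_low : lowering) (D_sq : D *m D = 0).

Lemma exact_mx_conc i (f : 'cV[K]_m) : exact_mx i ->
  (forall a, deg a != i -> f a 0 = 0) -> D *m f = 0 ->
  exists2 u : 'cV[K]_m, D *m u = f & forall a, deg a != i.+1 -> u a 0 = 0.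
Proof.
move=> ex fi Df; have [u uf] := ex f fi Df.
exists (\col_a (if deg a == i.+1 then u a 0 else 0)); last first.
  by move=> a /negPf ai; rewrite mxE ai.
apply/colP => a; rewrite mxE; case: (eqVneq (deg a) i) => [ai|ai].
  rewrite -uf mxE; apply: eq_bigr => b _; rewrite mxE; case: eqP => // bi.
  by have [->|/D_low] := eqVneq (D a b) 0; rewrite ?mul0r // => ba; rewrite ba ai in bi.
rewrite fi // big1 // => b _; rewrite mxE; case: eqP => [bi|_]; last by rewrite mulr0.
have [->|/D_low] := eqVneq (D a b) 0; rewrite ?mul0r // bi => -[ia].
by rewrite ia eqxx in ai.
Qed.

(** Over a field, exactness in degrees below [n] yields a homotopy from the identity
    to a map vanishing there. It is built degree by degree: the image of a basis
    element [c] is a preimage of the cycle [c - h (D c)]. *)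
Lemma contraction n : (forall i, (i < n)%N -> exact_mx i) ->
  exists h : 'M[K]_m,
    (forall a b, h a b != 0 -> deg a = (deg b).+1) /\
    (forall a c, (deg c < n)%N -> (D *m h + h *m D) a c = (a == c)%:R).
Proof.
elim: n => [|n IH] ex; first by exists 0; split => // a b; rewrite mxE eqxx.
have [i ni|h [h_up hP]] := IH; first by apply: ex; apply: ltnW.
have ucP c : exists u : 'cV[K]_m, deg c = n ->
    D *m u = col c (1%:M - h *m D) /\ (forall a, deg a != n.+1 -> u a 0 = 0).
  case: (eqVneq (deg c) n) => [cn|/eqP cn]; last by exists 0.
  have [||u Du uc] := exact_mx_conc (f := col c (1%:M - h *m D)) (ex n (ltnSn n)).
  - move=> a an; rewrite !mxE; case: (a =P c) an => [->|_ an]; first by rewrite cn eqxx.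
    rewrite big1 ?subr0 // => b _; apply/eqP; rewrite mulf_eq0; apply: contraTT an.
    by rewrite negb_or negbK => /andP[/h_up -> /D_low <-]; rewrite cn.
  - apply/colP => a; rewrite mulmx_col mulmxBr mulmx1 mulmxA !mxE.
    have E b : (D *m h) a b * D b c = (a == b)%:R * D b c - (h *m D) a b * D b c.
      have [->|Dbc] := eqVneq (D b c) 0; first by rewrite !mulr0 subr0.
      have bn : (deg b < n)%N by rewrite -cn (D_low Dbc).
      by rewrite -mulrBl -(hP a b bn) [(_ + _ : 'M_m) a b]mxE addrK.
    rewrite (eq_bigr _ (fun b _ => E b)) sumrB (bigD1 a) //= eqxx mul1r big1 ?addr0.
      rewrite opprB addrCA subrr addr0; move: (mulmxA h D D); rewrite D_sq mulmx0.
      by move/matrixP/(_ a c); rewrite !mxE => <-.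
    by move=> b; rewrite eq_sym => /negPf ->; rewrite mul0r.
  by exists u.
have [u uP] := fin_all_exists ucP.
exists (\matrix_(a, c) if deg c == n then u c a 0 else h a c); split.
  move=> a b; rewrite mxE; case: (deg b =P n) => [bn|_]; last exact: h_up.
  have [_ ub] := uP b bn; rewrite bn => ne; apply/eqP; apply: contraNT ne => /ub ->.
  by rewrite eqxx.
move=> a c; rewrite ltnS leq_eqVlt => /orP[/eqP cn|cn]; last first.
  rewrite -hP // !mxE; congr (_ + _); apply: eq_bigr => b _; rewrite mxE.
    by rewrite (ltn_eqF cn).
  have [->|Dbc] := eqVneq (D b c) 0; first by rewrite !mulr0.
  case: (deg b =P n) => // bn; move: cn; rewrite (D_low Dbc) bn => /ltnW; by rewrite ltnn.
have [Du _] := uP c cn.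
rewrite mxE.
have -> : (D *m \matrix_(a0, c0) (if deg c0 == n then u c0 a0 0 else h a0 c0)) a c = (D *m u c) a 0.
  by rewrite !mxE; apply: eq_bigr => b _; rewrite mxE cn eqxx.
rewrite Du !mxE [X in _ + X](_ : _ = \sum_b h a b * D b c) ?subrK //.
apply: eq_bigr => b _; rewrite mxE.
have [->|Dbc] := eqVneq (D b c) 0; first by rewrite !mulr0.
by case: (deg b =P n) => // bn; move: (D_low Dbc); rewrite cn bn => /eqP; rewrite ltn_eqF.
Qed.

(** A cycle outside the image of [D] survives in the cokernel of [D], whose
    coordinates are linear forms vanishing on the boundaries. *)
Lemma not_exact_functional i : ~ exact_mx i ->
  exists (f : 'cV[K]_m) (phi : 'rV[K]_m),
   [/\ forall a, deg a != i -> f a 0 = 0, D *m f = 0, phi *m D = 0 & phi *m f = 1].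
Proof.
move/not_all_ex_not=> [f nex].
have [fi {}nex] := imply_to_and _ _ nex.
have [Df {}nex] := imply_to_and _ _ nex.
have : ~~ (f^T <= D^T)%MS.
  apply/negP => /submxP[w fw]; apply: nex; exists w^T.
  by apply: trmx_inj; rewrite trmx_mul trmxK fw.
rewrite submxE => /eqP ne.
have [c nec] : exists c, f^T *m col c (cokermx D^T) != 0.
  apply: NNPP => /not_ex_all_not H; apply: ne; apply/matrixP => x c.
  move: (H c) => /negP; rewrite negbK mulmx_col => /eqP/colP/(_ x); by rewrite !mxE.
set ph := col c _ in nec.
have Dph : ph^T *m D = 0.
  by apply: trmx_inj; rewrite trmx_mul trmxK trmx0 /ph mulmx_col mulmx_coker col0.
have nec' : (ph^T *m f) 0 0 != 0.
  apply: contraNneq nec => e; apply/eqP; apply: trmx_inj; rewrite trmx_mul trmxK trmx0.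
  by rewrite [LHS]mx11_scalar e raddf0.
exists f, (((ph^T *m f) 0 0)^-1 *: ph^T); split=> //.
  by rewrite -scalemxAl Dph scaler0.
by rewrite -scalemxAl [X in _ *: X]mx11_scalar scale_scalar_mx mulVf.
Qed.

End One.

Section Two.
Variables (m1 m2 : nat) (deg1 : 'I_m1 -> nat) (deg2 : 'I_m2 -> nat).
Variables (D1 : 'M[K]_m1) (D2 : 'M[K]_m2).
Hypotheses (low1 : lowering deg1 D1) (low2 : lowering deg2 D2).
Hypotheses (sq1 : D1 *m D1 = 0) (sq2 : D2 *m D2 = 0).

Definition sign_mx : 'M[K]_m1 := \matrix_(a, b) ((-1) ^+ deg1 a *+ (a == b)).

(** The differential of the tensor product of two complexes, whose chains are written
    as matrices. *)
Definition tens (F : 'M[K]_(m1, m2)) : 'M[K]_(m1, m2) :=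
  D1 *m F + sign_mx *m F *m D2^T.

Definition exact_tens n := forall F : 'M[K]_(m1, m2),
  (forall a b, (deg1 a + deg2 b)%N != n -> F a b = 0) -> tens F = 0 ->
  exists U, tens U = F.

Lemma sign_mx_mul p (F : 'M[K]_(m1, p)) a b : (sign_mx *m F) a b = (-1) ^+ deg1 a * F a b.
Proof.
rewrite mxE (bigD1 a) //= mxE eqxx mulr1n big1 ?addr0 // => c.
by rewrite mxE eq_sym => /negPf ->; rewrite mulr0n mul0r.
Qed.

Lemma mul_sign_mx p (F : 'M[K]_(p, m1)) a b : (F *m sign_mx) a b = F a b * (-1) ^+ deg1 b.
Proof.
rewrite mxE (bigD1 b) //= mxE eqxx mulr1n big1 ?addr0 // => c.
by rewrite mxE => /negPf ->; rewrite mulr0n mulr0.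
Qed.

Lemma sign_mx_sq : sign_mx *m sign_mx = 1%:M.
Proof.
apply/matrixP => a b; rewrite sign_mx_mul !mxE; case: eqP => // _.
  by rewrite mulr1n -expr2 sqrr_sign.
by rewrite mulr0n mulr0.
Qed.

Lemma sign_mx_anti (M : 'M[K]_m1) :
  (forall a b, M a b != 0 -> deg1 b = (deg1 a).+1 \/ deg1 a = (deg1 b).+1) ->
  M *m sign_mx = - (sign_mx *m M).
Proof.
move=> Mdeg; apply/matrixP => a b; rewrite mul_sign_mx mxE sign_mx_mul.
have [->|/Mdeg[->|->]] := eqVneq (M a b) 0; first by rewrite mulr0 mul0r oppr0.
  by rewrite exprS mulN1r mulrN mulrC.
by rewrite exprS mulN1r mulNr opprK mulrC.
Qed.

(** With [h1] and [h2] contractions of the factors below [n1] and [n2], the maps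
    [1 - (D1 h1 + h1 D1)] and [1 - (D2 h2 + h2 D2)] are chain maps homotopic to the
    identity, so each cycle is homologous to its image under their tensor product.
    This image is supported in bidegrees at least [(n1, n2)], so it vanishes in total
    degree below [n1 + n2]. *)
Lemma kunneth_upper n1 n2 n :
  (forall i, (i < n1)%N -> exact_mx deg1 D1 i) ->
  (forall i, (i < n2)%N -> exact_mx deg2 D2 i) ->
  (n < n1 + n2)%N -> exact_tens n.
Proof.
move=> ex1 ex2 nn F Fn TF.
have [h1 [up1 hP1]] := contraction low1 sq1 ex1.
have [h2 [up2 hP2]] := contraction low2 sq2 ex2.
have D1s : D1 *m sign_mx = - (sign_mx *m D1) by apply: sign_mx_anti => a b /low1; left.
have h1s : h1 *m sign_mx = - (sign_mx *m h1) by apply: sign_mx_anti => a b /up1; right.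
set P1 := D1 *m h1 + h1 *m D1; set P2 := D2 *m h2 + h2 *m D2.
(* [G] is the image of [F] under the first map, and [G0] below says that the second
   map kills it. *)
pose G := F - P1 *m F.
have G_eq : tens (h1 *m F) = F - G.
  rewrite /G opprB addrCA subrr addr0 /tens /P1 mulmxDl !mulmxA; congr (_ + _).
  rewrite -[sign_mx *m h1]opprK -h1s; move/eqP: TF; rewrite /tens addr_eq0 => /eqP e.
  by rewrite -[h1 *m D1 *m F]mulmxA e mulmxN !mulmxA !mulNmx.
have TG : D1 *m G = - (sign_mx *m G *m D2^T).
  apply/eqP; rewrite -addr_eq0 -/(tens G); apply/eqP.
  have -> : G = F - tens (h1 *m F) by rewrite G_eq opprB addrCA subrr addr0.
  have tens2 X : tens (tens X) = 0.
    rewrite /tens !mulmxDr !mulmxDl !mulmxA sq1 mul0mx add0r D1s !mulNmx.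
    rewrite -!mulmxA -trmx_mul sq2 trmx0 !mulmx0 addr0 !mulmxA addrC subrr //.
  have tensB X Y : tens (X - Y) = tens X - tens Y.
    by rewrite /tens !mulmxBr mulmxBl addrACA opprD.
  by rewrite tensB TF tens2 subrr.
have G0 : G *m (1%:M - P2)^T = 0.
  apply/matrixP => a b; rewrite /G -{1}[F]mul1mx -mulmxBl mxE [RHS]mxE big1 // => c _.
  have -> : (1%:M - P2)^T c b = (b == c)%:R - P2 b c by rewrite mxE !mxE.
  have [bc|bc] := eqVneq (deg2 b) (deg2 c); last first.
    suff -> : (b == c)%:R - P2 b c = 0 :> K by rewrite mulr0.
    case: (b =P c) bc => [->|_ bc]; first by rewrite eqxx.
    rewrite !mxE !big1 ?addr0 ?subr0 // => d _; apply/eqP; rewrite mulf_eq0;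
    apply: contraTT bc; rewrite negb_or negbK.
      by case/andP=> /up2 -> /low2 ->.
    by case/andP=> /low2 + /up2 => -> [->].
  have [cn|cn] := ltnP (deg2 c) n2.
    by rewrite hP2 // subrr mulr0.
  rewrite mxE big1 ?mul0r // => d _.
  have -> : (1%:M - P1) a d = (a == d)%:R - P1 a d by rewrite !mxE.
  have [ad|ad] := eqVneq (deg1 a) (deg1 d); last first.
    suff -> : (a == d)%:R - P1 a d = 0 :> K by rewrite mul0r.
    case: (a =P d) ad => [->|_ ad]; first by rewrite eqxx.
    rewrite !mxE !big1 ?addr0 ?subr0 // => e _; apply/eqP; rewrite mulf_eq0;
    apply: contraTT ad; rewrite negb_or negbK.
      by case/andP=> /up1 -> /low1 ->.
    by case/andP=> /low1 + /up1 => -> [->].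
  have [dn|dn] := ltnP (deg1 d) n1; first by rewrite hP1 // subrr mul0r.
  rewrite Fn ?mulr0 // gtn_eqF // (leq_trans nn) // leq_add //.
have G_eq2 : G = G *m P2^T.
  by apply/eqP; rewrite -subr_eq0 -{1}[G]mulmx1 -mulmxBr -trmx1 -linearB G0.
exists (h1 *m F + sign_mx *m G *m h2^T).
have tensD X Y : tens (X + Y) = tens X + tens Y.
  by rewrite /tens !mulmxDr mulmxDl addrACA.
rewrite tensD G_eq (_ : tens (sign_mx *m G *m h2^T) = G) ?subrK //.
rewrite [RHS]G_eq2 /tens !mulmxA sign_mx_sq mul1mx D1s.
rewrite mulNmx mulNmx -[sign_mx *m D1 *m G]mulmxA TG mulmxN !mulNmx opprK !mulmxA sign_mx_sq mul1mx.
by rewrite /P2 linearD /= mulmxDr !trmx_mul !mulmxA addrC.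
Qed.

(** The product of the linear forms detecting a cycle of each factor detects the
    product of the cycles. *)
Lemma kunneth_lower i j : ~ exact_mx deg1 D1 i -> ~ exact_mx deg2 D2 j ->
  ~ exact_tens (i + j).
Proof.
move=> /not_exact_functional[f1 [p1 [f1i Df1 p1D pf1]]].
move=> /not_exact_functional[f2 [p2 [f2i Df2 p2D pf2]]] ex.
have [||U TU] := ex (f1 *m f2^T).
- move=> a b ab; rewrite mxE big_ord1 mxE.
  have [ai|/f1i ->] := eqVneq (deg1 a) i; last by rewrite mul0r.
  rewrite f2i ?mulr0 //; apply: contraNneq ab => ->; by rewrite ai.
- rewrite /tens mulmxA Df1 mul0mx add0r -!mulmxA -trmx_mul Df2 trmx0 !mulmx0 //.
have : p1 *m (f1 *m f2^T) *m p2^T = 1.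
  by rewrite mulmxA pf1 mul1mx -trmx_mul pf2 trmx1.
rewrite -TU /tens mulmxDr mulmxA p1D mul0mx add0r -!mulmxA -trmx_mul p2D trmx0 !mulmx0.
by move/matrixP/(_ 0 0)/eqP; rewrite !mxE eqxx eq_sym oner_eq0.
Qed.
End Two.
End MatrixComplex.

(** * The Kunneth formula for strands *)

Lemma big_disjU (R : Type) (idx : R) (op : Monoid.com_law idx) (I : finType)
    (A B : {set I}) (F : I -> R) : [disjoint A & B] ->
  \big[op/idx]_(i in A :|: B) F i =
    op (\big[op/idx]_(i in A) F i) (\big[op/idx]_(i in B) F i).
Proof. by move=> d; rewrite -bigU //; apply: eq_bigl => i; rewrite !inE. Qed.

Lemma sgn_setU (R : comNzRingType) (I : finType) (lt : rel I) e (T1 T2 : {set I}) :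
  [disjoint T1 & T2] -> sgn R lt e (T1 :|: T2) = sgn R lt e T1 * sgn R lt e T2.
Proof.
by move=> d; rewrite /sgn big_disjU.
Qed.

Section SetFamily.
Variables (I : finType) (Q : pred {set I}).
Implicit Types T : {set I}.

Definition family_set := {T : {set I} | Q T}.
Definition member (k : 'I_#|{: family_set}|) : {set I} := val (enum_val k).

Lemma memberP k : Q (member k).
Proof. exact: valP. Qed.

Lemma member_inj : injective member.
Proof. by move=> j k /val_inj /enum_val_inj. Qed.

Lemma member_surj T : Q T -> exists k, member k = T.
Proof.
by move=> QT; exists (enum_rank (exist _ T QT : family_set)); rewrite /member enum_rankK.
Qed.

(** As [member] is injective the sum has at most one term: this is extension by zero. *)
Definition extend (R : nmodType) (F : 'I_#|{: family_set}| -> R) T : R :=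
  \sum_(k | member k == T) F k.

Lemma extendE (R : nmodType) (F : 'I_#|{: family_set}| -> R) k : extend F (member k) = F k.
Proof. by rewrite /extend (big_pred1 k) // => k'; rewrite (inj_eq member_inj). Qed.
End SetFamily.

Section StrandMatrix.
Variables (K : fieldType) (V I : finType) (lt : rel I).
Hypothesis lt_tour : tournament lt.
Variables (g : I -> {set V}) (E : {set I}) (s : {set V}).
Implicit Types T : {set I}.
Let A := inside g E s.

Definition in_strand T := (T \subset inside g E s) && (cov g T == s).
Definition strand := family_set in_strand.
Definition strand_set (k : 'I_#|{: strand}|) : {set I} := member k.
Definition strand_deg k := #|strand_set k|.
Definition strand_mx : 'M[K]_#|{: strand}| :=
  \matrix_(j, k) \sum_(e in inside g E s :\: strand_set j | e |: strand_set j == strand_set k)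
     sgn K lt e (strand_set j).

Lemma strand_setP k : strand_set k \subset A /\ cov g (strand_set k) = s.
Proof. by have /andP[? /eqP] := memberP k. Qed.

Lemma strand_inj : injective strand_set.
Proof. exact: member_inj. Qed.

Lemma strand_surj T : T \subset A -> cov g T = s -> exists k, strand_set k = T.
Proof. by move=> TA cT; apply: member_surj; rewrite /in_strand TA cT eqxx. Qed.

Lemma strand_sum (f : {set I} -> K) j :
  \sum_k strand_mx j k * f (strand_set k) = bnd lt A f (strand_set j).
Proof.
under eq_bigr => k _ do rewrite mxE mulr_suml.
rewrite (exchange_big_dep (fun e => e \in A :\: strand_set j)) /=; last by move=> k e _ /andP[].
apply: eq_bigr => e; rewrite inE => /andP[eT eA].
have [Tj cj] := strand_setP j.
have [|k kE] := @strand_surj (e |: strand_set j) _ (cov_insideU eA cj).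
  by rewrite subUset sub1set eA.
rewrite (big_pred1 k) ?kE // => k'.
by rewrite eT eA /= -kE (inj_eq strand_inj) eq_sym.
Qed.

Lemma strand_low : lowering strand_deg strand_mx.
Proof.
move=> j k; rewrite mxE; apply: contraNeq => ne; rewrite big1 // => e.
rewrite !inE => /andP[/andP[eT eA] /eqP ejk]; case/eqP: ne.
by rewrite /strand_deg -ejk cardsU1 eT.
Qed.

Lemma strand_sq : strand_mx *m strand_mx = 0.
Proof.
apply/matrixP => j l; rewrite !mxE.
pose f := extend (fun k => (k == l)%:R : K).
transitivity (\sum_k strand_mx j k * bnd lt A f (strand_set k)).
  apply: eq_bigr => k _; rewrite -strand_sum; congr (_ * _).
  rewrite (bigD1 l) //= /f extendE eqxx mulr1 big1 ?addr0 // => l' ne.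
  by rewrite extendE (negPf ne) mulr0.
by rewrite strand_sum bnd_bnd.
Qed.

Lemma exact_strandP i : exact_at K lt g E s i <-> exact_mx strand_deg strand_mx i.
Proof.
split=> ex f.
  move=> fi Df.
  have [T TA Ti cT|u uP] := ex (extend (fun k => f k 0)).
    have [j <-] := strand_surj TA cT; rewrite -strand_sum.
    move/colP: Df => /(_ j); rewrite mxE [RHS]mxE => Dfj; rewrite -[RHS]Dfj.
    by apply: eq_bigr => k _; rewrite extendE.
  exists (\col_k (if strand_deg k == i.+1 then u (strand_set k) else 0)).
  apply/colP => j; rewrite mxE; case: (eqVneq (strand_deg j) i) => [ji|ji].
    have [TA cT] := strand_setP j.
    have := uP _ TA ji cT; rewrite extendE -strand_sum => <-.
    apply: eq_bigr => k _; rewrite [X in _ * X = _]mxE; case: eqP => // ki.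
    have [->|/strand_low e] := eqVneq (strand_mx j k) 0; first by rewrite !mul0r.
    by case: ki; rewrite e ji.
  rewrite fi // big1 // => k _; rewrite [X in _ * X = _]mxE.
  case: eqP => [ki|]; last by rewrite mulr0.
  have [->|/strand_low e] := eqVneq (strand_mx j k) 0; first by rewrite mul0r.
  by move: ji; move: ki; rewrite e => -[->]; rewrite eqxx.
move=> cyc.
have [||u uP] := ex (\col_k (if strand_deg k == i then f (strand_set k) else 0)).
- by move=> a /negPf ai; rewrite mxE ai.
- apply/colP => j; rewrite mxE [RHS]mxE; case: (eqVneq (strand_deg j).+1 i) => [ji|ji].
    have [TA cT] := strand_setP j.
    rewrite -[RHS](cyc _ TA ji cT) -strand_sum; apply: eq_bigr => k _; rewrite [X in _ * X = _]mxE.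
    case: eqP => // ki.
    have [->|/strand_low e] := eqVneq (strand_mx j k) 0; first by rewrite !mul0r.
    by case: ki; rewrite e ji.
  rewrite big1 // => k _; rewrite [X in _ * X = _]mxE; case: eqP => [ki|]; last by rewrite mulr0.
  have [->|/strand_low e] := eqVneq (strand_mx j k) 0; first by rewrite mul0r.
  by rewrite -ki e eqxx in ji.
exists (extend (fun k => u k 0)) => T TA Ti cT.
have [j jT] := strand_surj TA cT; rewrite -jT -/A -strand_sum.
move/colP: uP => /(_ j); rewrite mxE [RHS]mxE /strand_deg jT Ti eqxx => <-.
by apply: eq_bigr => k _; rewrite extendE.
Qed.
End StrandMatrix.

Section Kunneth.
Variables (K : fieldType) (V I : finType) (lt : rel I).
Hypothesis lt_tour : tournament lt.
Variables (g : I -> {set V}) (E1 E2 : {set I}) (V1 V2 : {set V}).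
Hypothesis gE1 : forall e, e \in E1 -> g e \subset V1.
Hypothesis gE2 : forall e, e \in E2 -> g e \subset V2.
Hypotheses (disE : [disjoint E1 & E2]) (disV : [disjoint V1 & V2]).

Implicit Types T : {set I}.
Section FixS.
Variable s : {set V}.
Hypothesis sV : s \subset V1 :|: V2.
Let s1 := s :&: V1.
Let s2 := s :&: V2.
Let A := inside g (E1 :|: E2) s.
Let A1 := inside g E1 s1.
Let A2 := inside g E2 s2.

Let A1P e : (e \in A1) = (e \in A) && (e \in E1).
Proof.
rewrite !inE; case eE: (e \in E1) => /=; rewrite ?andbF // andbT.
by rewrite subsetI gE1 // andbT.
Qed.

Let A2P e : (e \in A2) = (e \in A) && (e \in E2).
Proof.
rewrite !inE; case eE: (e \in E2) => /=; rewrite ?andbF // andbT orbT.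
by rewrite subsetI gE2 // andbT.
Qed.

Let AE : A = A1 :|: A2.
Proof. by apply/setP => e; rewrite in_setU A1P A2P -andb_orr !inE andbAC andbb. Qed.

Let disA : [disjoint A1 & A2].
Proof.
apply: disjointWl (disjointWr _ disE); apply/subsetP => e; first by rewrite A1P => /andP[].
by rewrite A2P => /andP[].
Qed.

Let T1 := @strand_set _ _ g E1 s1.
Let T2 := @strand_set _ _ g E2 s2.

(** The sign relating the basis element of [T1 :|: T2] to the tensor product of those
    of [T1] and [T2]; it is not 1 because [lt] need not put the labels of [T1] before
    those of [T2]. *)
Definition shuffle_sign (T1 T2 : {set I}) : K := \prod_(e1 in T1) \prod_(e2 in T2) (-1) ^+ lt e2 e1.

Lemma shuffle_sign_sq T T' : shuffle_sign T T' * shuffle_sign T T' = 1.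
Proof.
rewrite /shuffle_sign -big_split big1 //= => e _; rewrite -big_split big1 //= => e' _.
by rewrite -expr2 sqrr_sign.
Qed.

Lemma shuffle_signUl e T T' : e \notin T ->
  shuffle_sign (e |: T) T' = sgn K lt e T' * shuffle_sign T T'.
Proof. by move=> eT; rewrite /shuffle_sign big_setU1. Qed.

Lemma shuffle_signUr e T T' : e \notin T -> e \notin T' ->
  (-1) ^+ #|T| * shuffle_sign T (e |: T') = sgn K lt e T * shuffle_sign T T'.
Proof.
move=> eT eT'; rewrite /shuffle_sign /sgn -[(-1) ^+ _]/((-1) ^+ #|T|) -prodr_const -!big_split.
apply: eq_bigr => e1 e1T /=; rewrite big_setU1 //= mulrA; congr (_ * _).
rewrite (lt_tour (e := e1)); last by apply: contraNneq eT => <-.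
by case: (lt e e1); rewrite ?mulN1r ?opprK ?mulr1.
Qed.

Let F f : 'M[K]_(#|{: strand g E1 s1}|, #|{: strand g E2 s2}|) :=
  \matrix_(j, k) (shuffle_sign (T1 j) (T2 k) * f (T1 j :|: T2 k)).

Let d1 := @strand_deg _ _ g E1 s1.
Let d2 := @strand_deg _ _ g E2 s2.
Let D1 := strand_mx K lt g E1 s1.
Let D2 := strand_mx K lt g E2 s2.

Let T12 j k : [disjoint T1 j & T2 k].
Proof.
by apply: disjointWl (disjointWr _ disA); [case: (strand_setP j)|case: (strand_setP k)].
Qed.

(** For families with disjoint supports, a strand of the union is the tensor product
    of strands of the two families, through [F]. *)
Lemma tensE f j k : tens d1 D1 D2 (F f) j k =
  shuffle_sign (T1 j) (T2 k) * bnd lt A f (T1 j :|: T2 k).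
Proof.
have [jA _] := strand_setP j; have [kA _] := strand_setP k.
rewrite /tens mxE.
have -> : (D1 *m F f) j k =
   bnd lt A1 (fun T => shuffle_sign T (T2 k) * f (T :|: T2 k)) (T1 j).
  by rewrite -strand_sum mxE; apply: eq_bigr => j' _; rewrite [X in _ * X = _]mxE.
have -> : (sign_mx K d1 *m F f *m D2^T) j k = (-1) ^+ #|T1 j| *
   bnd lt A2 (fun T => shuffle_sign (T1 j) T * f (T1 j :|: T)) (T2 k).
  rewrite -mulmxA sign_mx_mul; congr (_ * _).
  rewrite -strand_sum mxE; apply: eq_bigr => j' _.
  by rewrite [X in X * _ = _]mxE [X in _ * X = _]mxE mulrC.
rewrite /bnd AE setDUl.
rewrite big_disjU /=; last first.
  by apply: disjointWl (disjointWr _ disA); apply: subsetDl.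
have A1T e : e \in A1 -> e \notin T2 k.
  by move=> eA; apply/negP => /(subsetP kA); rewrite -/A2 (disjointFr disA eA).
have A2T e : e \in A2 -> e \notin T1 j.
  by move=> eA; apply/negP => /(subsetP jA); rewrite -/A1 (disjointFl disA eA).
rewrite mulrDr !mulr_sumr; congr (_ + _).
  apply: eq_big => e; rewrite !in_setD -/A1.
    by case eA: (e \in A1); rewrite ?andbF // in_setU negb_or A1T ?andbT.
  move=> /andP[eT _]; rewrite shuffle_signUl // sgn_setU // setUA; ring.
apply: eq_big => e; rewrite !in_setD -/A2.
  by case eA: (e \in A2); rewrite ?andbF // in_setU negb_or A2T.
move=> /andP[eT eA]; rewrite sgn_setU // setUCA.
have := shuffle_signUr (A2T e eA) eT; rewrite -/T1 => epsE.
set fe := f _; have -> (x y z : K) : x * (y * (z * fe)) = (x * z) * y * fe by ring.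
rewrite epsE; ring.
Qed.

Lemma tens_local (M M' : 'M[K]_(#|{: strand g E1 s1}|, #|{: strand g E2 s2}|)) j k :
  (forall j' k', (d1 j' + d2 k')%N = (d1 j + d2 k).+1 -> M j' k' = M' j' k') ->
  tens d1 D1 D2 M j k = tens d1 D1 D2 M' j k.
Proof.
move=> MM'; rewrite /tens mxE [RHS]mxE -!mulmxA !sign_mx_mul.
congr (_ + _ * _); rewrite !mxE; apply: eq_bigr => i _.
  have [->|/strand_low e] := eqVneq (D1 j i) 0; first by rewrite !mul0r.
  by rewrite MM' // /d1 e addSn.
rewrite [D2^T _ _]mxE; have [->|/strand_low e] := eqVneq (D2 k i) 0; first by rewrite !mulr0.
by rewrite MM' // /d2 e addnS.
Qed.

Let T12P j k : T1 j :|: T2 k \subset A /\ cov g (T1 j :|: T2 k) = s.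
Proof.
have [jA cj] := strand_setP j; have [kA ck] := strand_setP k; split.
  by rewrite AE setUSS.
by rewrite /cov bigcup_setU -/(cov g _) -/(cov g (T2 k)) cj ck -setIUr; apply/setIidPl.
Qed.

Let T12_surj T : T \subset A -> cov g T = s -> exists j k, T1 j :|: T2 k = T.
Proof.
move=> TA cT.
have cI E' V' (W : {set V}) (A' := inside g E' (s :&: V')) :
    (forall e, e \in A -> e \in A' \/ g e \subset W) ->
  [disjoint V' & W] -> cov g (T :&: A') = s :&: V'.
  move=> AA' dW; apply/eqP; rewrite eqEsubset (cov_inside (subsetIr _ _)) /=.
  apply/subsetP => x /setIP[xs xV]; move: xs; rewrite -cT => /bigcupP[e eT xe].
  have [eA'|eW] := AA' e (subsetP TA _ eT).
    by apply/bigcupP; exists e => //; rewrite inE eT.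
  by move: (disjointFr dW xV); rewrite (subsetP eW).
have AD e : e \in A -> e \in A1 \/ e \in A2 by rewrite AE inE => /orP.
have c1 : cov g (T :&: A1) = s1.
  apply: cI disV => e /AD[|]; [by left|rewrite A2P => /andP[_ /gE2]; by right].
have c2 : cov g (T :&: A2) = s2.
  apply: (cI _ _ V1) => [e /AD[|]|]; last by rewrite disjoint_sym.
    by rewrite A1P => /andP[_ /gE1]; right.
  by left.
have [j jT] := strand_surj (subsetIr T A1) c1.
have [k kT] := strand_surj (subsetIr T A2) c2.
by exists j, k; rewrite /T1 /T2 jT kT -setIUr -AE; apply/setIidPl.
Qed.

Let G (M : 'M[K]_(#|{: strand g E1 s1}|, #|{: strand g E2 s2}|)) T : K :=
  \sum_(p | T1 p.1 :|: T2 p.2 == T) shuffle_sign (T1 p.1) (T2 p.2) * M p.1 p.2.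

Let FG M : F (G M) = M.
Proof.
apply/matrixP => j k; rewrite mxE /G (big_pred1 (j, k)) /=.
  by rewrite mulrA shuffle_sign_sq mul1r.
move=> [j' k'] /=; apply/eqP/eqP => [e|[-> ->]] //.
have [jA _] := strand_setP j; have [kA _] := strand_setP k.
have [jA' _] := strand_setP j'; have [kA' _] := strand_setP k'.
have IA T T' : T \subset A1 -> T' \subset A2 -> (T :|: T') :&: A1 = T /\ (T :|: T') :&: A2 = T'.
  move=> TA1 TA2; rewrite !setIUl (setIidPl TA1) (setIidPl TA2); split.
    apply/setUidPl; apply: subset_trans (_ : set0 \subset _); last exact: sub0set.
    by rewrite subset0 setI_eq0 disjoint_sym (disjointWr TA2).
  apply/setUidPr; apply: subset_trans (_ : set0 \subset _); last exact: sub0set.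
  by rewrite subset0 setI_eq0 (disjointWl TA1).
have [e1 e2] := IA _ _ jA kA; have [e1' e2'] := IA _ _ jA' kA'.
congr (_, _); apply: strand_inj.
  by rewrite -e1 -e1' -/(T1 j') -/(T2 k') e.
by rewrite -e2 -e2' -/(T1 j') -/(T2 k') e.
Qed.

Let cardT12 j k : #|T1 j :|: T2 k| = (d1 j + d2 k)%N.
Proof. by apply/eqP; rewrite leq_card_setU T12. Qed.

Lemma exact_tensP n : exact_at K lt g (E1 :|: E2) s n <-> exact_tens d1 d2 D1 D2 n.
Proof.
have epsK T T' (x y : K) : shuffle_sign T T' * x = shuffle_sign T T' * y -> x = y.
  by move/(congr1 ( *%R (shuffle_sign T T'))); rewrite !mulrA shuffle_sign_sq !mul1r.
have tens0 : tens d1 D1 D2 0 = 0 by rewrite /tens !mulmx0 mul0mx addr0.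
split=> ex M.
  move=> Mn TM.
  have [T TA Tn cT|u uP] := ex (G M).
    have [j [k <-]] := T12_surj TA cT.
    by apply: (epsK (T1 j) (T2 k)); rewrite -tensE FG TM mxE mulr0.
  exists (\matrix_(j, k) if (d1 j + d2 k == n.+1)%N then F u j k else 0).
  apply/matrixP => j k; case: (eqVneq (d1 j + d2 k)%N n) => [jk|jk].
    have [TA cT] := T12P j k.
    transitivity (tens d1 D1 D2 (F u) j k).
      by apply: tens_local => j' k' jk'; rewrite mxE jk' jk eqxx.
    by rewrite tensE (uP _ TA) ?cardT12 // -[in RHS](FG M) [RHS]mxE.
  rewrite Mn //.
  transitivity (tens d1 D1 D2 0 j k); last by rewrite tens0 !mxE.
  by apply: tens_local => j' k' jk'; rewrite !mxE jk' eqSS (negPf jk).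
move=> cyc.
have [||U TU] := ex (\matrix_(j, k) if (d1 j + d2 k == n)%N then F M j k else 0).
- by move=> a b /negPf ab; rewrite mxE ab.
- apply/matrixP => j k; rewrite [RHS]mxE; case: (eqVneq (d1 j + d2 k).+1 n) => [jk|jk].
    have [TA cT] := T12P j k.
    transitivity (tens d1 D1 D2 (F M) j k).
      by apply: tens_local => j' k' jk'; rewrite mxE jk' jk eqxx.
    by rewrite tensE cyc ?mulr0 // cardT12.
  transitivity (tens d1 D1 D2 0 j k); last by rewrite tens0 !mxE.
  by apply: tens_local => j' k' jk'; rewrite !mxE jk' (negPf jk).
exists (G U) => T TA Tn cT; have [j [k jkT]] := T12_surj TA cT.
rewrite -jkT in Tn *; apply: (epsK (T1 j) (T2 k)).
by rewrite -tensE FG TU mxE -cardT12 Tn eqxx mxE.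
Qed.

End FixS.

(** The strand at [s] is the tensor product of those at [s :&: V1] and [s :&: V2], so
    regularity is subadditive. *)
Lemma kunneth_reg_le r1 r2 : reg_le K lt g E1 r1 -> reg_le K lt g E2 r2 ->
  reg_le K lt g (E1 :|: E2) (r1 + r2).
Proof.
move=> rE1 rE2 s n rn.
case: (boolP (s \subset V1 :|: V2)) => sV; last first.
  apply: exact_no_cover; apply: contraNneq sV => <-; apply/bigcupsP => e.
  rewrite !inE => /andP[/orP[/gE1|/gE2] eV _]; apply: subset_trans eV _.
    exact: subsetUl.
  exact: subsetUr.
apply/(exact_tensP sV).
have cs : #|s| = (#|s :&: V1| + #|s :&: V2|)%N.
  rewrite -{1}(setIidPl sV) setIUr; apply/eqP; rewrite leq_card_setU.
  by apply: disjointWl (disjointWr _ disV); apply: subsetIr.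
have low := @strand_low; have sq := @strand_sq.
apply: (@kunneth_upper _ _ _ _ _ _ _ (low _ _ _ _ _ _ _) (low _ _ _ _ _ _ _)
  (sq _ _ _ _ lt_tour _ _ _) (sq _ _ _ _ lt_tour _ _ _)
  (#|s :&: V1| - r1)%N (#|s :&: V2| - r2)%N) => [i|i|].
- by rewrite ltn_subRL => ri; apply/exact_strandP; apply: rE1.
- by rewrite ltn_subRL => ri; apply/exact_strandP; apply: rE2.
by move: rn; rewrite cs; lia.
Qed.

Lemma kunneth_not_exact (s1 s2 : {set V}) i j : s1 \subset V1 -> s2 \subset V2 ->
  ~ exact_at K lt g E1 s1 i -> ~ exact_at K lt g E2 s2 j ->
  ~ exact_at K lt g (E1 :|: E2) (s1 :|: s2) (i + j).
Proof.
move=> s1V s2V n1 n2 /(exact_tensP (setUSS s1V s2V)).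
have -> : (s1 :|: s2) :&: V1 = s1.
  rewrite setIUl (setIidPl s1V) (_ : s2 :&: V1 = set0) ?setU0 //.
  by apply/eqP; rewrite setI_eq0 disjoint_sym (disjointWr s2V).
have -> : (s1 :|: s2) :&: V2 = s2.
  rewrite setIUl (setIidPl s2V) (_ : s1 :&: V2 = set0) ?set0U //.
  by apply/eqP; rewrite setI_eq0 (disjointWl s1V).
by apply: kunneth_lower => /exact_strandP.
Qed.

End Kunneth.

(** * Finite generation of polynomial submodules *)

Lemma ex_minimal (P : nat -> Prop) k : P k -> exists2 k0, P k0 & forall j, (j < k0)%N -> ~ P j.
Proof.
elim/ltn_ind: k => k IH Pk.
case: (classic (exists2 j, (j < k)%N & P j)) => [[j jk Pj]|nj]; first exact: IH Pj.
by exists k => // j jk Pj; apply: nj; exists j.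
Qed.

Lemma functional_choice (A B : Type) (P : A -> B -> Prop) :
  (forall a, exists b, P a b) -> exists f, forall a, P a (f a).
Proof.
move=> H; exists (fun a => proj1_sig (constructive_indefinite_description _ (H a))) => a.
exact: proj2_sig.
Qed.

Section Dickson.
Variable n : nat.

(** Dickson's lemma by induction on the coordinates. Let [s] work for the coordinates
    in [l], and let [B] bound the exponents of [i] in [s]. Members of [Q] whose
    exponent of [i] is at least [B] are handled by [s]; the others fall into finitely
    many classes where this exponent is constant, and each class is an instance of the
    induction hypothesis. *)
Lemma dickson_coords (l : seq 'I_n) (Q : 'X_{1..n} -> Prop) :
  exists s : seq 'X_{1..n}, (forall m, m \in s -> Q m) /\
    forall m, Q m -> exists2 m', m' \in s & forall i, i \in l -> (m' i <= m i)%N.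
Proof.
elim: l Q => [|i l IH] Q.
  case: (classic (exists m, Q m)) => [[m Qm]|nQ].
    by exists [:: m]; split=> [m'|m' _]; [rewrite inE => /eqP ->|exists m; rewrite ?inE].
  by exists [::]; split=> // m Qm; case: nQ; exists m.
have [s [sQ sP]] := IH Q.
pose B := (\max_(m <- s) m i)%N.
have [S SP] : exists S : nat -> seq 'X_{1..n}, forall c,
    (forall m, m \in S c -> Q m /\ m i = c) /\
    (forall m, Q m -> m i = c -> exists2 m', m' \in S c & forall j, j \in l -> (m' j <= m j)%N).
  apply: (functional_choice (P := fun c s => (forall m, m \in s -> Q m /\ m i = c) /\
    (forall m, Q m -> m i = c -> exists2 m', m' \in s & forall j, j \in l -> (m' j <= m j)%N))).
  move=> c; have [s' [s'Q s'P]] := IH (fun m => Q m /\ m i = c).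
  by exists s'; split=> [//|m Qm mc]; apply: s'P.
exists (s ++ flatten [seq S c | c <- iota 0 B]); split=> m.
  rewrite mem_cat => /orP[/sQ //|/flatten_mapP[c _ mS]].
  by have [/(_ _ mS)[]] := SP c.
move=> Qm; have [mB|mB] := leqP B (m i).
  have [m' m's le] := sP m Qm; exists m'; first by rewrite mem_cat m's.
  move=> j; rewrite inE => /orP[/eqP ->|/le //].
  by apply: leq_trans mB; apply: (@leq_bigmax_seq _ s xpredT (fun m : 'X_{1..n} => m i)).
have [_ /(_ m Qm erefl)[m' m'S le]] := SP (m i).
exists m' => [|j].
  by rewrite mem_cat; apply/orP; right; apply/flatten_mapP; exists (m i); rewrite // mem_iota.
rewrite inE => /orP[/eqP ->|/le //].
by have [/(_ m' m'S)[_ ->]] := SP (m i).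
Qed.

Lemma dickson (Q : 'X_{1..n} -> Prop) : exists s : seq 'X_{1..n},
  (forall m, m \in s -> Q m) /\ forall m, Q m -> exists2 m', m' \in s & (m' <= m)%MM.
Proof.
have [s [sQ sP]] := dickson_coords (enum 'I_n) Q.
exists s; split=> // m /sP[m' m's le]; exists m' => //.
by apply/mnm_lepP => i; apply: le; rewrite mem_enum.
Qed.
End Dickson.

Section Noether.
Variables (K : fieldType) (n : nat).
Local Notation S := {mpoly K[n]}.

Definition submodule r (N : 'rV[S]_r -> Prop) :=
  N 0 /\ forall (c : S) u v, N u -> N v -> N (c *: u + v).

Lemma submodule_mul r (N : 'rV[S]_r -> Prop) k (w : 'rV_k) (A : 'M_(k, r)) :
  submodule N -> (forall a, N (row a A)) -> N (w *m A).
Proof.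
move=> [N0 NL] NA; rewrite mulmx_sum_row.
elim/big_ind: _ => [//|u v Nu Nv|a _]; first by rewrite -[u]scale1r; apply: NL.
by rewrite -[_ *: _]addr0; apply: NL.
Qed.

(** Division with remainder: finitely many elements of [N], whose leading monomials in
    coordinate [i] generate all those that occur, suffice to cancel the coordinate [i]
    of any element of [N]. *)
Lemma leading_term_reduction r (N N' : 'rV[S]_r -> Prop) (i : 'I_r) : submodule N ->
  (forall v, N' v <-> N v /\ v 0 i = 0) ->
  exists k (B : 'M[S]_(k, r)), (forall a, N (row a B)) /\
    forall v, N v -> exists w, N' (v - w *m B).
Proof.
move=> Nsub N'E.
pose Q m := exists v, [/\ N v, v 0 i != 0 & mlead (v 0 i) = m].
have [s [sQ sP]] := dickson Q.
have [f fP] : exists f : 'X_{1..n} -> 'rV[S]_r, forall m, m \in s ->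
    [/\ N (f m), f m 0 i != 0 & mlead (f m 0 i) = m].
  apply: (functional_choice (P := fun m v =>
    m \in s -> [/\ N v, v 0 i != 0 & mlead (v 0 i) = m])) => m.
  by case: (boolP (m \in s)) => [/sQ[v vP]|_]; [exists v|exists 0].
exists (size s), (\matrix_a f (nth 0%MM s a)); split=> [a|v].
  by rewrite rowK; have [] := fP (nth 0%MM s a) (mem_nth _ (ltn_ord a)).
move: {2}(mlead _) (erefl (mlead (v 0 i))) => m.
elim/(@ltmwf n): m v => m IH v vm Nv.
have [v0|v0] := eqVneq (v 0 i) 0.
  by exists 0; rewrite mul0mx subr0 N'E.
have [|m' m's le] := sP m; first by exists v.
have [Nf f0 fm] := fP m' m's.
pose c := (v 0 i)@_m / (f m' 0 i)@_m'.
(* The multiple of [f m'] with the leading term of [v] in coordinate [i]. *)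
pose q : S := c *: 'X_[m - m'].
pose v' := v - q *: f m'.
have Nv' : N v'.
  by rewrite /v' addrC -scaleNr; apply Nsub.2.
have m's' : (index m' s < size s)%N by rewrite index_mem.
pose a0 := Ordinal m's'.
have rowa : row a0 (\matrix_a f (nth 0%MM s a)) = f m' by rewrite rowK nth_index.
suff [w wP] : exists w, N' (v' - w *m \matrix_(a < size s) f (nth 0%MM s a)).
  exists (w + q *: delta_mx 0 a0); rewrite mulmxDl -scalemxAl -rowE rowa.
  by rewrite opprD addrA addrAC.
have [v'0|v'0] := eqVneq (v' 0 i) 0.
  by exists 0; rewrite mul0mx subr0 N'E.
apply: (IH (mlead (v' 0 i))) => //.
have vc : (v 0 i)@_m != 0 by rewrite -vm mleadc_eq0.
have fc : (f m' 0 i)@_m' != 0 by rewrite -[X in _@_X]fm mleadc_eq0.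
have c0 : c != 0 by rewrite mulf_neq0 // invr_eq0.
have lq : mlead (q * f m' 0 i) = m.
  have X0 : 'X_[m - m'] != 0 :> S by rewrite -mleadc_eq0 mleadXm mcoeffX eqxx oner_eq0.
  have q0 : q != 0 by rewrite scaler_eq0 negb_or c0.
  by rewrite mleadM // mleadZ // mleadXm fm submK.
have v'E : v' 0 i = v 0 i - q * f m' 0 i by rewrite !mxE.
have le' : (mlead (v' 0 i) <= m)%O.
  rewrite v'E; apply: le_trans (mleadB_le _ _) _; by rewrite lq vm joinxx.
rewrite lt_neqAle le' andbT; apply: contraNneq v'0 => e.
rewrite -mleadc_eq0 e v'E mcoeffB /q -scalerAl mcoeffZ [_ * f m' 0 i]mulrC.
rewrite -[X in (f m' 0 i * _)@_X](submK le) mcoeffMX /c.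
by rewrite divfK ?subrr.
Qed.

(** The elements with vanishing first [k] coordinates form a submodule; generators for
    [k.+1] and those that reduce the coordinate [k] generate it. *)
Lemma submodule_fin_gen r (N : 'rV[S]_r -> Prop) : submodule N ->
  exists k (A : 'M[S]_(k, r)), (forall a, N (row a A)) /\
    forall v, N v -> exists w, v = w *m A.
Proof.
move=> Nsub.
pose Nk k v := N v /\ forall i : 'I_r, (i < k)%N -> v 0 i = 0.
have Nksub k : submodule (Nk k).
  split; first by split=> [|i _]; [exact: Nsub.1|rewrite mxE].
  move=> c u v [Nu u0] [Nv v0]; split; first exact: Nsub.2.
  by move=> i ik; rewrite !mxE u0 // v0 // mulr0 addr0.
suff H j : (j <= r)%N -> exists k (A : 'M[S]_(k, r)), (forall a, Nk (r - j)%N (row a A)) /\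
    forall v, Nk (r - j)%N v -> exists w, v = w *m A.
  have [k [A [AN AP]]] := H r (leqnn r).
  exists k, A; split=> [a|v Nv]; first by have [] := AN a.
  by apply: AP; split=> // i; rewrite subnn.
elim: j => [_|j IH jr].
  exists 0%N, 0; split=> [[]//|v [_ v0]]; exists 0; rewrite mul0mx.
  by apply/rowP => i; rewrite v0 ?subn0 // mxE.
have [k [A [AN AP]]] := IH (ltnW jr).
have ir : (r - j.+1 < r)%N by lia.
have [|k' [B [BN BP]]] :=
    @leading_term_reduction r (Nk (r - j.+1)%N) (Nk (r - j)%N) (Ordinal ir) (Nksub _).
  move=> v; split=> [[Nv v0]|[[Nv v0] vi]].
    by split; [split=> // i ii; apply: v0; lia|apply: v0 => /=; lia].
  split=> // i ii; have [lt|ge] := ltnP i (r - j.+1)%N; first exact: v0.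
  by rewrite -[RHS]vi; congr (v _ _); apply: val_inj => /=; lia.
exists (k + k')%N, (col_mx A B); split=> [a|v Nv].
  rewrite -[a]splitK; case: split => b /=; rewrite ?rowKu ?rowKd //.
  have [Na a0] := AN b; split=> // i ii; apply: a0; lia.
have [w /AP[w' w'E]] := BP v Nv.
by exists (row_mx w' w); rewrite mul_row_col -w'E subrK.
Qed.

End Noether.

(** * Existence of minimal graded resolutions *)

Lemma mcoeff_pihomog (K : fieldType) n d (p : {mpoly K[n]}) m :
  (pihomog mdeg d p)@_m = if mdeg m == d then p@_m else 0.
Proof.
rewrite pihomogE raddf_sum /=.
under eq_bigr => m' _ do rewrite mcoeffZ mcoeffX.
case: (boolP (m \in msupp p)) => [mp|mp].
  case: eqP => [md|/eqP md]; last first.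
    rewrite big1 // => m' /eqP m'd; case: eqP => [e|]; last by rewrite mulr0.
    by rewrite -m'd e eqxx in md.
  rewrite big_mkcond (bigD1_seq m) ?msupp_uniq //= md eqxx eqxx mulr1 big1 ?addr0 //.
  by move=> m' /negPf ->; rewrite mulr0 if_same.
rewrite memN_msupp_eq0 // if_same big_seq_cond big1 // => m' /andP[m'p _].
by case: eqP mp => [<-|]; rewrite ?m'p // mulr0.
Qed.

Section Graded.
Variables (K : fieldType) (n : nat).
Local Notation S := {mpoly K[n]}.

(** [t] and [s] are the degrees of the basis elements of the source and of the target,
    and the map preserves degrees. *)
Definition graded_mx k r (t : 'I_k -> nat) (s : 'I_r -> nat) (A : 'M[S]_(k, r)) :=
  forall a b m, m \in msupp (A a b) -> (s b + mdeg m)%N = t a.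

Definition homog_part k r (t : 'I_k -> nat) (s : 'I_r -> nat) (A : 'M[S]_(k, r)) : 'M[S]_(k, r) :=
  \matrix_(a, b) if (s b <= t a)%N then pihomog mdeg (t a - s b) (A a b) else 0.

Lemma mcoeff_homog_part k r (t : 'I_k -> nat) (s : 'I_r -> nat) (A : 'M[S]_(k, r)) a b m :
  (homog_part t s A a b)@_m = if (s b + mdeg m == t a)%N then (A a b)@_m else 0.
Proof.
rewrite mxE; case: leqP => st; last by rewrite mcoeff0 ifN //; lia.
by rewrite mcoeff_pihomog; congr (if _ then _ else _); lia.
Qed.

Lemma homog_part_graded k r (t : 'I_k -> nat) (s : 'I_r -> nat) (A : 'M[S]_(k, r)) :
  graded_mx t s (homog_part t s A).
Proof.
by move=> a b m; rewrite mcoeff_msupp mcoeff_homog_part; case: ifP => [/eqP //|]; rewrite eqxx.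
Qed.

Lemma homog_part_id k r (t : 'I_k -> nat) (s : 'I_r -> nat) (A : 'M[S]_(k, r)) :
  graded_mx t s A -> homog_part t s A = A.
Proof.
move=> gA; apply/matrixP => a b; apply/mpolyP => m; rewrite mcoeff_homog_part.
case: eqP => // ne; apply/esym; apply/eqP; rewrite mcoeff_eq0.
by apply/negP => /gA.
Qed.

Lemma homog_partB k r (t : 'I_k -> nat) (s : 'I_r -> nat) (A B : 'M[S]_(k, r)) :
  homog_part t s (A - B) = homog_part t s A - homog_part t s B.
Proof.
apply/matrixP => a b; apply/mpolyP => m.
rewrite mcoeff_homog_part [in RHS]mxE [(- homog_part _ _ _) _ _]mxE mcoeffB !mcoeff_homog_part.
by rewrite !mxE mcoeffB; case: ifP => // _; rewrite subr0.
Qed.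

Lemma pihomog_mul d e (p q : S) : q \is e.-homog ->
  pihomog mdeg d (p * q) = if (e <= d)%N then pihomog mdeg (d - e) p * q else 0.
Proof.
move=> qe; rewrite {1}[p]mpolyE mulr_suml raddf_sum /=.
have E m : pihomog mdeg d (p@_m *: 'X_[m] * q) =
    if mdeg m + e == d then p@_m *: 'X_[m] * q else 0.
  have h : (p@_m *: 'X_[m] * q) \is (mdeg m + e).-homog.
    by rewrite -scalerAl; apply: dhomogZ; apply: dhomogM; rewrite ?dhomogX.
  case: eqP => [<-|/eqP ne]; first exact: pihomog_dE.
  exact: pihomog_ne0 ne h.
rewrite (eq_bigr _ (fun m _ => E m)) -big_mkcond /=.
case: leqP => ed; last by rewrite big1 // => m; lia.
by rewrite pihomogE mulr_suml; apply: eq_bigl => m; rewrite -{1}(subnK ed) eqn_add2r.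
Qed.

Lemma homog_part_mul k l r (u : 'I_k -> nat) (t : 'I_l -> nat) (s : 'I_r -> nat)
    (w : 'M[S]_(k, l)) (A : 'M[S]_(l, r)) :
  graded_mx t s A -> homog_part u s (w *m A) = homog_part u t w *m A.
Proof.
move=> gA; apply/matrixP => a b; rewrite [LHS]mxE [RHS]mxE.
case: leqP => su.
  rewrite mxE raddf_sum /=; apply: eq_bigr => c _; rewrite mxE.
  have [A0|A0] := eqVneq (A c b) 0; first by rewrite A0 !mulr0 raddf0.
  have hA : A c b \is (t c - s b).-homog.
    by apply/dhomogP => m /gA /esym ->; rewrite addKn.
  have st : (s b <= t c)%N by rewrite -(gA c b _ (mlead_supp A0)) leq_addr.
  rewrite (pihomog_mul _ _ hA); have [tu|tu] := leqP (t c) (u a).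
    by rewrite leq_sub2r //; congr (pihomog _ _ _ * _); lia.
  by rewrite leqNgt (_ : (u a - s b < t c - s b)%N) ?mul0r //; lia.
rewrite big1 // => c _.
have [->|A0] := eqVneq (A c b) 0; first by rewrite mulr0.
have := gA c b _ (mlead_supp A0) => e.
by rewrite mxE leqNgt (_ : (u a < t c)%N) ?mul0r //; lia.
Qed.

(** If a homogeneous matrix factors through [A] at all, the homogeneous part of any
    factor is a homogeneous factor. *)
Lemma graded_lift k l r (u : 'I_k -> nat) (t : 'I_l -> nat) (s : 'I_r -> nat)
    (M : 'M[S]_(k, r)) (A : 'M[S]_(l, r)) :
  graded_mx u s M -> graded_mx t s A ->
  (forall a, exists w, row a M = w *m A) ->
  exists2 X, M = X *m A & graded_mx u t X.
Proof.
move=> gM gA liftM.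
have [w wP] := fin_all_exists liftM.
exists (homog_part u t (\matrix_a w a)); last exact: homog_part_graded.
rewrite -(homog_part_mul _ _ gA) -[LHS](homog_part_id gM); congr homog_part.
by apply/row_matrixP => a; rewrite row_mul rowK wP.
Qed.

Lemma graded_mul k l r (u : 'I_k -> nat) (t : 'I_l -> nat) (s : 'I_r -> nat)
    (w : 'M[S]_(k, l)) (A : 'M[S]_(l, r)) :
  graded_mx u t w -> graded_mx t s A -> graded_mx u s (w *m A).
Proof.
move=> gw gA; rewrite -(homog_part_id gw) -(homog_part_mul _ _ gA).
exact: homog_part_graded.
Qed.

Definition graded_submodule r (s : 'I_r -> nat) (N : 'rV[S]_r -> Prop) :=
  submodule N /\ forall d v, N v -> N (homog_part (fun=> d) s v).

Definition generates k r (t : 'I_k -> nat) (s : 'I_r -> nat) (N : 'rV[S]_r -> Prop)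
    (A : 'M[S]_(k, r)) :=
  graded_mx t s A /\ forall v, N v <-> exists w, v = w *m A.

Lemma homog_part_sum r (s : 'I_r -> nat) k (A : 'M[S]_(k, r)) :
  exists D, forall a, row a A = \sum_(d < D) homog_part (fun=> val d) s (row a A).
Proof.
exists (\sum_a \sum_b (s b + msize (A a b))).+1 => a.
apply/rowP => b; rewrite summxE; apply/mpolyP => m; rewrite raddf_sum /=.
under eq_bigr => d _ do rewrite mcoeff_homog_part.
case: (boolP (m \in msupp (row a A 0 b))) => [mA|/memN_msupp_eq0 ->]; last first.
  by rewrite big1 // => d _; rewrite if_same.
have lt : (s b + mdeg m < (\sum_a \sum_b (s b + msize (A a b))).+1)%N.
  rewrite ltnS (bigD1 a) //= (bigD1 b) //= -!addnA leq_add2l.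
  by move: mA; rewrite mxE => /msize_mdeg_lt /ltnW /leq_trans; apply; apply: leq_addr.
rewrite (bigD1 (Ordinal lt)) //= eqxx big1 ?addr0 // => d ne.
by rewrite ifN // eq_sym; apply: contraNneq ne => e; apply/eqP; apply: val_inj.
Qed.

Lemma graded_generators r (s : 'I_r -> nat) N : graded_submodule s N ->
  exists k (t : 'I_k -> nat) (A : 'M[S]_(k, r)), generates t s N A.
Proof.
move=> [Nsub Nh]; have [k [A [NA genA]]] := submodule_fin_gen Nsub.
have [D DP] := homog_part_sum s A.
pose X := ('I_k * 'I_D)%type.
exists #|{: X}|, (fun p => val (enum_val p).2).
exists (\matrix_p homog_part (fun=> val (enum_val p).2) s (row (enum_val p).1 A)); split.
  move=> p b m; rewrite mxE => mp.
  exact: (@homog_part_graded _ _ (fun=> val (enum_val p).2) s (row (enum_val p).1 A) 0 b m mp).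
move=> v; split=> [/genA[w ->]|[w ->]]; last first.
  by apply: submodule_mul => // p; rewrite rowK; apply: Nh.
exists (\row_p w 0 (enum_val p).1).
rewrite !mulmx_sum_row; under [RHS]eq_bigr => p _ do rewrite mxE rowK.
rewrite -(big_enum_val (fun p : X => w 0 p.1 *: homog_part (fun=> val p.2) s (row p.1 A))) /=.
under eq_bigr => a _ do rewrite DP scaler_sumr.
by rewrite pair_bigA /=; apply: eq_bigl.
Qed.

Definition min_generates k r (t : 'I_k -> nat) (s : 'I_r -> nat) (N : 'rV[S]_r -> Prop)
    (A : 'M[S]_(k, r)) :=
  generates t s N A /\ forall w : 'rV_k, w *m A = 0 -> forall a, (w 0 a)@_0%MM = 0.

(** A homogeneous generating family of least size has only relations without constant
    coefficients: the homogeneous part of a relation with a non-zero constant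
    coefficient at [a] expresses the generator [a] through the others. *)
Lemma minimal_generators r (s : 'I_r -> nat) N : graded_submodule s N ->
  exists k (t : 'I_k -> nat) (A : 'M[S]_(k, r)), min_generates t s N A.
Proof.
move=> /graded_generators[k0 gen0].
have [k [t [A [gA genA]]] kmin] :=
  ex_minimal (P := fun k => exists (t : 'I_k -> nat) (A : 'M[S]_(k, r)), generates t s N A) gen0.
exists k, t, A; split=> // w wA a; apply/eqP/negP => /negP wa.
case: k => [|k] in t A gA genA kmin w wA a wa *; first by case: a wa.
apply: (kmin k) => //; exists (fun b => t (lift a b)), (row' a A); split.
  by move=> b c m; rewrite mxE => /gA.
set c := (w 0 a)@_0%MM in wa.
pose u := homog_part (fun=> t a) t w.
have uA : u *m A = 0.
  by rewrite /u -(homog_part_mul _ _ gA) wA; apply/matrixP => ? ?; rewrite !mxE raddf0 if_same.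
have ua : u 0 a = c%:MP.
  apply/mpolyP => m; rewrite mcoeff_homog_part mcoeffC -[X in _ == X]addn0 eqn_add2l mdeg_eq0.
  by case: eqP => [->|_]; rewrite ?mulr1 ?mulr0.
have drop_a (w2 : 'rV[S]_k.+1) : w2 0 a = 0 -> w2 *m A = col' a w2 *m row' a A.
  move=> w20; rewrite !mulmx_sum_row (bigD1_ord a) //= w20 scale0r add0r.
  by apply: eq_bigr => b _; rewrite mxE; congr (_ *: _); apply/rowP => ?; rewrite !mxE.
move=> v; split=> [/genA[x ->]|[x ->]].
  (* Subtracting a multiple of the relation [u] removes the generator [a] from the
     combination [x]. *)
  pose x' := x - (x 0 a * c^-1%:MP) *: u.
  have -> : x *m A = x' *m A by rewrite mulmxBl -scalemxAl uA scaler0 subr0.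
  exists (col' a x'); apply: drop_a.
  rewrite /x'; move: ua; move: u {uA x'} => u ua.
  by rewrite !mxE ua -mulrA -mpolyCM mulVf // mpolyC1 mulr1 subrr.
apply/genA; exists (\row_b (if unlift a b is Some b' then x 0 b' else 0)).
rewrite drop_a ?mxE ?unlift_none //; congr (_ *m _); apply/rowP => b.
by rewrite !mxE liftK.
Qed.

End Graded.

Section MinimalResolution.
Variables (K : fieldType) (n : nat).
Local Notation S := {mpoly K[n]}.
Variable P : S -> Prop.
Hypotheses (P0 : P 0) (PL : forall c p q, P p -> P q -> P (c * p + q)).
Hypotheses (Ph : forall d p, P p -> P (pihomog mdeg d p)) (Pm : forall p, P p -> p@_0%MM = 0).

Record gens r := Gens { gens_rank : nat; gens_shift : 'I_gens_rank -> nat;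
  gens_mx : 'M[S]_(gens_rank, r) }.

Definition min_gens r (s : 'I_r -> nat) (N : 'rV[S]_r -> Prop) : gens r :=
  epsilon (inhabits (@Gens r 0 (fun=> 0%N) 0))
    (fun G => min_generates (@gens_shift _ G) s N (gens_mx G)).

Lemma min_gensP r (s : 'I_r -> nat) N : graded_submodule s N ->
  min_generates (@gens_shift _ (min_gens s N)) s N (gens_mx (min_gens s N)).
Proof.
move=> /minimal_generators[k [t [A AP]]].
apply: (epsilon_spec (inhabits (@Gens r 0 (fun=> 0%N) 0))
  (fun G => min_generates (@gens_shift _ G) s N (gens_mx G))).
by exists (Gens t A).
Qed.

(** A free module of the resolution together with generators of the submodule that the
    next differential has to hit. The next free module has by definition as many basis
    elements as there are generators, which makes consecutive differentials composable
    without casts. *)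
Record stage := Stage { stage_rank : nat; stage_shift : 'I_stage_rank -> nat;
  stage_gens : gens stage_rank }.

Definition next_stage (st : stage) : stage :=
  @Stage (gens_rank (stage_gens st)) (@gens_shift _ (stage_gens st))
    (min_gens (@gens_shift _ (stage_gens st)) (fun w => w *m gens_mx (stage_gens st) = 0)).

Definition zero_shift : 'I_1 -> nat := fun=> 0%N.

Fixpoint stages i : stage :=
  if i is i'.+1 then next_stage (stages i')
  else @Stage 1 zero_shift (min_gens zero_shift (fun v => P (v 0 0))).

Definition resolution : free_complex K n :=
  @FreeComplex K n (fun i => stage_rank (stages i)) (fun i => @stage_shift (stages i))
    (fun i => gens_mx (stage_gens (stages i))) 1.

Let N0 : graded_submodule zero_shift (fun v : 'rV[S]_1 => P (v 0 0)).
Proof.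
split; [split|]; first by rewrite mxE.
  by move=> c u v Pu Pv; rewrite !mxE; apply: PL.
by move=> d v Pv; rewrite mxE subn0; apply: Ph.
Qed.

Let kerN k r (t : 'I_k -> nat) (s : 'I_r -> nat) (A : 'M[S]_(k, r)) :
  graded_mx t s A -> graded_submodule t (fun w : 'rV_k => w *m A = 0).
Proof.
move=> gA; split; [split|]; first by rewrite mul0mx.
  by move=> c u v uA vA; rewrite mulmxDl -scalemxAl uA vA scaler0 addr0.
move=> d v vA; rewrite -(homog_part_mul _ _ gA) vA.
by apply/matrixP => a b; rewrite !mxE raddf0 if_same.
Qed.

Lemma stage_graded i : graded_mx (@gens_shift _ (stage_gens (stages i))) (@stage_shift (stages i))
  (gens_mx (stage_gens (stages i))).
Proof.
elim: i => [|i IH]; first by have [[]] := min_gensP N0.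
by have [[]] := min_gensP (kerN IH).
Qed.

Lemma stage_minimal i (w : 'rV_(gens_rank (stage_gens (stages i)))) :
  w *m gens_mx (stage_gens (stages i)) = 0 -> forall a, (w 0 a)@_0%MM = 0.
Proof.
case: i w => [|i]; first by have [_] := min_gensP N0.
by have [_] := min_gensP (kerN (@stage_graded i)).
Qed.

(** Every row of a differential is a relation between the rows of the preceding one,
    which generate minimally, so it has no constant coefficients; the rows of the
    first differential lie in the ideal, whose elements have no constant coefficients
    either. *)
Lemma resolution_minimal : minimal_graded_resolution P resolution.
Proof.
split.
- split=> [a|i a b m]; last exact: stage_graded.
  by rewrite mxE !ord1 eqxx mulr1n; apply: dhomog1.
- split=> [p|v|i v].
  + exists (const_mx p); rewrite mulmx1 mxE subrr //.
  + by rewrite mulmx1; have [[_ H] _] := min_gensP N0; apply: H.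
  by have [[_ H] _] := min_gensP (kerN (@stage_graded i)); apply: H.
case=> [|i] a b.
  have [[_ H] _] := min_gensP N0.
  have : P ((row a (gens_mx (min_gens zero_shift (fun v => P (v 0 0))))) 0 0).
    by apply/H; exists (delta_mx 0 a); rewrite rowE.
  by move/Pm; rewrite mxE [b]ord1.
have [[_ H] _] := min_gensP (kerN (@stage_graded i)).
have : row a (gens_mx (stage_gens (stages i.+1))) *m gens_mx (stage_gens (stages i)) = 0.
  by apply/H; exists (delta_mx 0 a); rewrite rowE.
by move/stage_minimal/(_ b); rewrite mxE.
Qed.

End MinimalResolution.

(** * Comparison of graded resolutions *)

Lemma dependent_choice (T : nat -> Type) (R : forall i, T i -> T i.+1 -> Prop) (x0 : T 0%N) :
  (forall i x, exists y, R i x y) ->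
  exists f : forall i, T i, f 0%N = x0 /\ forall i, R i (f i) (f i.+1).
Proof.
move=> H.
pose step i x := proj1_sig (constructive_indefinite_description _ (H i x)).
exists (fix f i : T i := if i is i'.+1 then step i' (f i') else x0); split=> // i.
exact: (proj2_sig (constructive_indefinite_description _ (H i _))).
Qed.

Section Comparison.
Variables (K : fieldType) (n : nat).
Local Notation S := {mpoly K[n]}.
Variable P : S -> Prop.
Hypotheses (P0 : P 0) (PL : forall c p q, P p -> P q -> P (c * p + q)).
Hypotheses (Ph : forall d p, P p -> P (pihomog mdeg d p)).

Let PD p q : P p -> P q -> P (p + q).
Proof. by rewrite -[p in P (p + q)]mul1r; apply: PL. Qed.

Let PM c p : P p -> P (c * p).
Proof. by rewrite -[c * p]addr0 => Pp; apply: PL. Qed.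

Let PB p q : P p -> P q -> P (p - q).
Proof. by move=> Pp Pq; rewrite addrC -mulN1r; apply: PL. Qed.

(** The cycles of the complex augmented by the quotient of [S] by [P], so that
    exactness of a resolution has the same form in all degrees. *)
Definition augmented_cycle (F : free_complex K n) i : 'rV[S]_(rank F i) -> Prop :=
  if i is i'.+1 then fun v => v *m diff F i' = 0 else fun v => P ((v *m aug F) 0 0).

Lemma augmented_exact F i v : resolves F P ->
  augmented_cycle v <-> exists w, v = w *m diff F i.
Proof. by case: i v => [|i] v [_ H0 HS]; [apply: H0|apply: HS]. Qed.

Lemma row_diff_cycle F i a : resolves F P -> augmented_cycle (row a (diff F i)).
Proof. by move=> rF; apply/augmented_exact => //; exists (delta_mx 0 a); rewrite rowE. Qed.

Definition graded_resolution F := graded_complex F /\ resolves F P.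

Definition chain_map (F G : free_complex K n) (f : forall i, 'M[S]_(rank F i, rank G i)) :=
  (forall a, P ((aug F - f 0%N *m aug G) a 0)) /\
  forall i, diff F i *m f i = f i.+1 *m diff G i.

(** The map is lifted along the exactness of [G]. What makes each step possible is
    that the preceding map sends augmented cycles to augmented cycles. *)
Lemma chain_map_exists F G : graded_resolution F -> graded_resolution G ->
  exists f : forall i, 'M[S]_(rank F i, rank G i),
    chain_map f /\ forall i, graded_mx (@shift _ _ F i) (@shift _ _ G i) (f i).
Proof.
move=> [gF rF] [gG rG].
pose good i (f : 'M[S]_(rank F i, rank G i)) := graded_mx (@shift _ _ F i) (@shift _ _ G i) f /\
  forall v, augmented_cycle v -> augmented_cycle (v *m f).
have [f0 f0g f0P] : exists2 f : 'M[S]_(rank F 0, rank G 0),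
    graded_mx (@shift _ _ F 0) (@shift _ _ G 0) f & forall a, P ((aug F - f *m aug G) a 0).
  have [w wP] := fin_all_exists (fun a => let: And3 H _ _ := rG in H (aug F a 0)).
  have augG : graded_mx (@shift _ _ G 0) (fun=> 0%N : nat) (aug G).
    by move=> a b m; rewrite [b]ord1 => mG; rewrite add0n (dhomog_mf (gG.1 a) mG).
  have augF : graded_mx (@shift _ _ F 0) (fun=> 0%N : nat) (aug F).
    by move=> a b m; rewrite [b]ord1 => mF; rewrite add0n (dhomog_mf (gF.1 a) mF).
  exists (homog_part (@shift _ _ F 0) (@shift _ _ G 0) (\matrix_a w a)) => [|a].
    exact: homog_part_graded.
  rewrite -(homog_part_mul _ _ augG) -{1}(homog_part_id augF) -homog_partB mxE leq0n subn0.
  apply: Ph; have := wP a; congr P; rewrite !mxE; congr (_ - _).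
  by apply: eq_bigr => c _; rewrite !mxE.
have good0 : good 0%N f0.
  split=> // v /= Pv.
  have -> : (v *m f0 *m aug G) 0 0 = (v *m aug F) 0 0 - (v *m (aug F - f0 *m aug G)) 0 0.
    by rewrite mulmxBr mulmxA !mxE opprB addrCA subrr addr0.
  apply: PB => //; rewrite mxE; apply: (big_ind P) => // a _; exact: PM.
have step i (x : {f | good i f}) : exists y : {f | good i.+1 f},
    diff F i *m sval x = sval y *m diff G i.
  case: x => f [fg fZ] /=.
  have gfd : graded_mx (@shift _ _ F i.+1) (@shift _ _ G i) (diff F i *m f).
    exact: graded_mul (gF.2 i) fg.
  have [a|f' f'E f'g] := graded_lift gfd (gG.2 i).
    by rewrite row_mul; apply/augmented_exact => //; apply: fZ; apply: row_diff_cycle.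
  have f'P : good i.+1 f'.
    by split=> // v /= vZ; rewrite -mulmxA -f'E mulmxA vZ mul0mx.
  by exists (exist _ f' f'P).
have [f [f_0 fS]] := dependent_choice (exist _ f0 good0) step.
exists (fun i => sval (f i)); split; last by move=> i; have [] := svalP (f i).
split; last exact: fS.
by move=> a; rewrite f_0; apply: f0P.
Qed.

(** Once the part of [phi] accounted for by the preceding homotopy is subtracted, what
    remains takes its values in cycles and lifts by exactness. *)
Lemma homotopy_exists F (phi : forall i, 'M[S]_(rank F i)) : resolves F P ->
  (forall a, P ((phi 0%N *m aug F) a 0)) ->
  (forall i, diff F i *m phi i = phi i.+1 *m diff F i) ->
  exists h : forall i, 'M[S]_(rank F i, rank F i.+1),
    phi 0%N = h 0%N *m diff F 0 /\
    forall i, phi i.+1 = diff F i *m h i + h i.+1 *m diff F i.+1.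
Proof.
move=> rF phi0 phiC.
have lift i k (M : 'M[S]_(k, rank F i)) : (forall a, augmented_cycle (row a M)) ->
    exists h, M = h *m diff F i.
  move=> MZ.
  have [w wP] := fin_all_exists (fun a => (augmented_exact (row a M) rF).1 (MZ a)).
  by exists (\matrix_a w a); apply/row_matrixP => a; rewrite row_mul rowK.
pose good i (h : 'M[S]_(rank F i, rank F i.+1)) :=
  forall v, augmented_cycle v -> v *m (phi i - h *m diff F i) = 0.
have [h0 h0E] : exists h, phi 0%N = h *m diff F 0.
  by apply: lift => a /=; rewrite -row_mul mxE; apply: phi0.
have good0 : good 0%N h0 by move=> v _; rewrite h0E subrr mulmx0.
have step i (x : {h | good i h}) : exists y : {h | good i.+1 h},
    phi i.+1 = diff F i *m sval x + sval y *m diff F i.+1.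
  case: x => h hZ /=.
  have [a|h' h'E] := lift i.+1 _ (phi i.+1 - diff F i *m h).
    rewrite /= -row_mul mulmxBl -phiC -mulmxA -mulmxBr row_mul hZ //.
    exact: row_diff_cycle.
  have h'P : good i.+1 h'.
    by move=> v /= vZ; rewrite -h'E opprB addrCA subrr addr0 mulmxA vZ mul0mx.
  by exists (exist _ h' h'P); rewrite /= -h'E addrCA subrr addr0.
have [h [h_0 hS]] := dependent_choice (exist _ h0 good0) step.
by exists (fun i => sval (h i)); split=> //; rewrite h_0.
Qed.

Lemma homotopy_inverse F G (f : forall i, 'M[S]_(rank F i, rank G i))
    (g : forall i, 'M[S]_(rank G i, rank F i)) :
  resolves F P -> chain_map f -> chain_map g ->
  exists h : forall i, 'M[S]_(rank F i, rank F i.+1),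
    1%:M - f 0%N *m g 0%N = h 0%N *m diff F 0 /\
    forall i, 1%:M - f i.+1 *m g i.+1 = diff F i *m h i + h i.+1 *m diff F i.+1.
Proof.
move=> rF [f0 fS] [g0 gS].
apply: (homotopy_exists (phi := fun i => 1%:M - f i *m g i)) => // [a|i].
  rewrite mulmxBl mul1mx.
  have -> : aug F - f 0%N *m g 0%N *m aug F =
      (aug F - f 0%N *m aug G) + f 0%N *m (aug G - g 0%N *m aug F).
    by rewrite mulmxBr mulmxA addrA subrK.
  rewrite mxE; apply: PD => //.
  by rewrite mxE; apply: (big_ind P) => // b _; apply: PM.
by rewrite mulmxBr mulmxBl mulmx1 mul1mx mulmxA fS -!mulmxA gS.
Qed.

(** Reduction modulo the ideal of the variables. *)
Definition mod_max k l (A : 'M[S]_(k, l)) : 'M[K]_(k, l) := map_mx (mcoeff 0%MM) A.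

Lemma mod_maxM k l r (A : 'M[S]_(k, l)) (B : 'M[S]_(l, r)) :
  mod_max (A *m B) = mod_max A *m mod_max B.
Proof. exact: map_mxM. Qed.

Lemma mod_maxD k l (A B : 'M[S]_(k, l)) : mod_max (A + B) = mod_max A + mod_max B.
Proof. exact: map_mxD. Qed.

Lemma mod_maxB k l (A B : 'M[S]_(k, l)) : mod_max (A - B) = mod_max A - mod_max B.
Proof. exact: map_mxB. Qed.

Lemma mod_max1 k : mod_max (1%:M : 'M[S]_k) = 1%:M.
Proof. exact: map_mx1. Qed.

Definition tor_cycle (G : free_complex K n) i : 'rV[K]_(rank G i) -> Prop :=
  if i is i'.+1 then fun z => z *m mod_max (diff G i') = 0 else fun=> True.

(** The vanishing of [Tor_i (S/P, K)] in degree [j], computed from the resolution [G]. *)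
Definition tor_zero G i j := forall z : 'rV[K]_(rank G i),
  (forall a, shift a != j -> z 0 a = 0) -> tor_cycle z ->
  exists u, z = u *m mod_max (diff G i).

Lemma graded_const k l (t : 'I_k -> nat) (s : 'I_l -> nat) (A : 'M[S]_(k, l)) a b :
  graded_mx t s A -> mod_max A a b != 0 -> s b = t a.
Proof.
by move=> gA; rewrite mxE -mcoeff_msupp => /gA; rewrite mdeg0 addn0.
Qed.

(** The chain maps between [F] and [G] are inverse to each other up to homotopy.
    Modulo the variables the differentials of [F] vanish, and with them every
    null-homotopic endomorphism, so the reduction of [F] is isomorphic to the homology
    of the reduction of [G]. *)
Lemma minimal_shift_tor F G i j : minimal_graded_resolution P F -> graded_resolution G ->
  (exists a : 'I_(rank F i), shift a = j) <-> ~ tor_zero G i j.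
Proof.
move=> [gF rF mF] GG.
have FF : graded_resolution F by [].
have [f [fC fg]] := chain_map_exists FF GG; have [g [gC gg]] := chain_map_exists GG FF.
have mF0 k : mod_max (diff F k) = 0 by apply/matrixP => a b; rewrite !mxE mF.
split.
  move=> [a aj] tz.
  have [h [h0 hS]] := homotopy_inverse rF fC gC.
  have [b bj||u uE] := tz (row a (mod_max (f i))).
  - rewrite mxE; apply/eqP; apply: contraNT bj => /(graded_const (fg i)) ->.
    by rewrite aj.
  - case: (i) a aj => //= i' a _; rewrite -row_mul -mod_maxM -fC.2 mod_maxM mF0 mul0mx.
    by apply/rowP => b; rewrite !mxE.
  have : row a (mod_max (1%:M - f i *m g i)) = 0.
    case: (i) a {aj uE u} => [|i'] a.
      by rewrite h0 mod_maxM mF0 mulmx0; apply/rowP => b; rewrite !mxE.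
    rewrite hS mod_maxD !mod_maxM !mF0 mulmx0 mul0mx addr0.
    by apply/rowP => b; rewrite !mxE.
  rewrite mod_maxB mod_max1 mod_maxM linearB /= row_mul uE -mulmxA -mod_maxM gC.2.
  rewrite mod_maxM mF0 !mulmx0 subr0 => /rowP/(_ a); rewrite !mxE eqxx.
  by move/eqP; rewrite oner_eq0.
move=> ntz; apply: NNPP => nex; apply: ntz => z zj zc.
have [h [h0 hS]] := homotopy_inverse GG.2 gC fC.
have zg : z *m mod_max (g i) = 0.
  apply/rowP => b; rewrite mxE [RHS]mxE big1 // => a _.
  have [e|/eqP ne] := eqVneq (mod_max (g i) a b) 0; first by rewrite e mulr0.
  rewrite zj ?mul0r //; apply/eqP => aj; apply: nex; exists b.
  by rewrite -aj; apply: graded_const (gg i) _; apply/eqP.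
have zE : z = z *m mod_max (1%:M - g i *m f i).
  by rewrite mod_maxB mod_max1 mod_maxM mulmxBr mulmx1 mulmxA zg mul0mx subr0.
exists (z *m mod_max (h i)); rewrite {1}zE {zE zg zj}.
case: (i) z zc => [|i'] z /= zc; first by rewrite h0 mod_maxM mulmxA.
by rewrite hS mod_maxD !mod_maxM mulmxDr mulmxA zc mul0mx add0r mulmxA.
Qed.

End Comparison.

(** * The Taylor resolution *)

Lemma sgn_rmorph (R R' : comNzRingType) (I : finType) (lt : rel I)
    (phi : {rmorphism R -> R'}) e (T : {set I}) : phi (sgn R lt e T) = sgn R' lt e T.
Proof.
by rewrite /sgn rmorph_prod; apply: eq_bigr => e' _; rewrite rmorphXn rmorphN rmorph1.
Qed.

Section Taylor.
Variables (K : fieldType) (V I : finType) (lt : rel I).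
Hypothesis lt_tour : tournament lt.
Variables (g : I -> {set V}) (E : {set I}).
Local Notation N := #|V|.
Local Notation S := {mpoly K[N]}.
Implicit Types (T : {set I}) (s : {set V}) (M : 'X_{1..N}).

Definition set_mnm s : 'X_{1..N} := [multinom nat_of_bool (enum_val i \in s) | i < N].

Lemma set_mnmE s (x : V) : set_mnm s (enum_rank x) = (x \in s).
Proof. by rewrite mnmE enum_rankK. Qed.

Lemma set_mnm_le s M : reflect (forall x, x \in s -> (0 < M (enum_rank x))%N) (set_mnm s <= M)%MM.
Proof.
apply: (iffP mnm_lepP) => [H x xs|H i].
  by have := H (enum_rank x); rewrite set_mnmE xs.
by rewrite mnmE; case: (boolP (_ \in s)) => // /H; rewrite enum_valK.
Qed.

Lemma mdeg_set_mnm s : mdeg (set_mnm s) = #|s|.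
Proof.
rewrite mdegE -sum1_card [RHS]big_mkcond /= (reindex (@enum_rank V)) /=; last first.
  exact/onW_bij/enum_rank_bij.
by apply: eq_bigr => x _; rewrite set_mnmE; case: (_ \in s).
Qed.

Lemma set_mnm_eq0 s : (set_mnm s == 0%MM) = (s == set0).
Proof. by rewrite -mdeg_eq0 mdeg_set_mnm cards_eq0. Qed.

Lemma set_mnmU_le s s' M :
  (set_mnm (s :|: s') <= M)%MM = (set_mnm s <= M)%MM && (set_mnm s' <= M)%MM.
Proof.
apply/set_mnm_le/andP => [H|[/set_mnm_le H /set_mnm_le H'] x].
  by split; apply/set_mnm_le => x xs; apply: H; rewrite inE xs ?orbT.
by rewrite inE => /orP[/H|/H'].
Qed.

Lemma set_mnmD s s' : (set_mnm (s :\: s') + set_mnm s')%MM = set_mnm (s :|: s').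
Proof.
by apply/mnmP => i; rewrite mnmDE !mnmE !inE; case: (_ \in s); case: (_ \in s').
Qed.

Definition set_monomial s : S := 'X_[set_mnm s].

Definition monomial_ideal (p : S) : Prop :=
  exists w : I -> S, p = \sum_(e in E) w e * set_monomial (g e).

Lemma mcoeffXM a (q : S) m :
  ('X_[a] * q)@_m = if (a <= m)%MM then q@_(m - a) else 0.
Proof.
rewrite mulrC; case: ifPn => am; first by rewrite -{1}(submK am) addmC mcoeffMX.
apply/eqP; rewrite mcoeff_eq0 (perm_mem (msuppMX q a)); apply: contra am => /mapP[m' _ ->].
exact: lem_addr.
Qed.

Lemma mcoeff_sgn e T (q : S) m : (sgn S lt e T * q)@_m = sgn K lt e T * q@_m.
Proof.
by rewrite -(sgn_rmorph _ (@mpolyC N K)) mcoeffCM.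
Qed.

(** The basis element of [T] stands for the least common multiple of the [g e],
    [e \in T], which is the monomial of [cov g T]. *)
Definition taylor_bnd (f : {set I} -> S) T : S :=
  \sum_(e in E :\: T) sgn S lt e T * (set_monomial (g e :\: cov g T) * f (e |: T)).

(** The coefficient of a chain in multidegree [M], the basis element of [T] having the
    multidegree of [cov g T]. *)
Definition coef_at M (f : {set I} -> S) T : K :=
  if (set_mnm (cov g T) <= M)%MM then (f T)@_(M - set_mnm (cov g T)) else 0.

Definition below M : {set I} := [set e in E | (set_mnm (g e) <= M)%MM].

Lemma below_sub M T : (T \subset below M) = (T \subset E) && (set_mnm (cov g T) <= M)%MM.
Proof.
apply/subsetP/andP => [H|[/subsetP TE /set_mnm_le cT] e eT].
  split; first by apply/subsetP => e /H; rewrite inE => /andP[].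
  apply/set_mnm_le => x /bigcupP[e /H]; rewrite inE => /andP[_ /set_mnm_le H' xe]; exact: H'.
rewrite inE TE //=; apply/set_mnm_le => x xe; apply: cT.
by apply/bigcupP; exists e.
Qed.

(** In multidegree [M] the Taylor complex is the complex of the full simplex on the
    generators dividing the monomial [M]. *)
Lemma coef_taylor_bnd M f T : (set_mnm (cov g T) <= M)%MM ->
  coef_at M (taylor_bnd f) T = bnd lt (below M) (coef_at M f) T.
Proof.
move=> cM; rewrite /coef_at cM /taylor_bnd raddf_sum /=.
rewrite (bigID (fun e => (set_mnm (g e) <= M)%MM)) /= [X in _ + X]big1 ?addr0; last first.
  move=> e /andP[_ eM]; rewrite mcoeff_sgn mcoeffXM ifN ?mulr0 //.
  apply: contra eM => le; have : (set_mnm (g e :|: cov g T) <= M)%MM.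
    rewrite -set_mnmD; apply/mnm_lepP => i; move/mnm_lepP/(_ i): le; move/mnm_lepP/(_ i): cM.
    by rewrite mnmDE mnmBE; lia.
  by rewrite set_mnmU_le => /andP[].
apply: eq_big => [e|e /andP[_ eM]]; first by rewrite !inE andbA.
have eTM : (set_mnm (g e :|: cov g T) <= M)%MM by rewrite set_mnmU_le eM.
rewrite mcoeff_sgn mcoeffXM covU1 eTM; congr (_ * _).
have E1 : (M - set_mnm (g e :|: cov g T) = M - set_mnm (cov g T) - set_mnm (g e :\: cov g T))%MM.
  by apply/mnmP => i; rewrite -set_mnmD !mnmE; lia.
rewrite ifT ?E1 //; apply/mnm_lepP => i.
by move/mnm_lepP/(_ i): eTM; rewrite -set_mnmD mnmDE mnmBE; lia.
Qed.

Lemma coef_at_ext (f f' : {set I} -> S) T :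
  (forall M, (set_mnm (cov g T) <= M)%MM -> coef_at M f T = coef_at M f' T) -> f T = f' T.
Proof.
move=> H; apply/mpolyP => m.
have le : (set_mnm (cov g T) <= m + set_mnm (cov g T))%MM by apply: lem_addl.
by have := H _ le; rewrite /coef_at le addmK.
Qed.

Lemma taylor_bnd_sq f T : T \subset E -> taylor_bnd (taylor_bnd f) T = 0.
Proof.
move=> TE; apply: (coef_at_ext (f' := fun=> 0)) => M cM.
rewrite coef_taylor_bnd // [RHS]/coef_at cM mcoeff0.
rewrite -[RHS](bnd_bnd lt_tour (below M) (coef_at M f) T).
apply: eq_bnd => e; rewrite !inE => /andP[_ /andP[_ eM]].
by rewrite coef_taylor_bnd // covU1 set_mnmU_le eM.
Qed.

Definition apex M : option I := [pick e in below M].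

(** The coning by [e], applied only in those multidegrees whose chosen apex is [e]. It
    is linear over [K] but not over the polynomial ring, since the apex varies with
    the multidegree. *)
Definition homotopy_term T e (q : S) : S :=
  \sum_(m <- msupp q | apex (m + set_mnm (cov g (T :\ e)))%MM == Some e)
     q@_m *: 'X_[m + set_mnm (cov g (T :\ e)) - set_mnm (cov g T)].

Definition taylor_homotopy (f : {set I} -> S) T : S :=
  \sum_(e in T) sgn S lt e (T :\ e) * homotopy_term T e (f (T :\ e)).

Lemma cov_sub_le T T' : T \subset T' -> (set_mnm (cov g T) <= set_mnm (cov g T'))%MM.
Proof.
move=> TT'; apply/set_mnm_le => x xT; rewrite set_mnmE (subsetP (cov_sub g TT')) //.
Qed.

Lemma coef_homotopy_term M T e q : e \in T -> (set_mnm (cov g T) <= M)%MM ->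
  (homotopy_term T e q)@_(M - set_mnm (cov g T)) =
    if apex M == Some e then q@_(M - set_mnm (cov g (T :\ e))) else 0.
Proof.
move=> eT cM; set c' := set_mnm (cov g (T :\ e)).
have c'M : (c' <= M)%MM by apply: lepm_trans cM; apply: cov_sub_le; apply: subsetDl.
rewrite /homotopy_term raddf_sum /=.
under eq_bigr => m _ do rewrite mcoeffZ mcoeffX.
have key m : apex (m + c')%MM == Some e ->
    ((m + c' - set_mnm (cov g T))%MM == (M - set_mnm (cov g T))%MM) = (m == (M - c')%MM).
  move=> ap; have cm : (set_mnm (cov g T) <= m + c')%MM.
    rewrite -{1}(setD1K eT) covU1 set_mnmU_le lem_addl andbT.
    move: ap; rewrite /apex; case: pickP => // e' ; rewrite inE => /andP[_ le] /eqP[<-] //.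
  apply/eqP/eqP => [|->]; last by rewrite submK.
  move/(congr1 (fun x => (x + set_mnm (cov g T))%MM)); rewrite !submK // => <-.
  by rewrite addmK.
case: (boolP ((M - c')%MM \in msupp q)) => [mq|mq].
  case: ifP => ap.
    rewrite big_mkcond (bigD1_seq (M - c')%MM) ?msupp_uniq //= -/c' submK // ap eqxx mulr1.
    rewrite big1 ?addr0 // => m ne; case: ifP => // apm.
    by rewrite key // (negPf ne) mulr0.
  rewrite big1 // => m apm; rewrite key //; case: eqP => [e1|]; last by rewrite mulr0.
  by move: apm; rewrite e1 submK // ap.
rewrite [in RHS](memN_msupp_eq0 mq) if_same big_seq_cond big1 // => m /andP[mq' apm].
rewrite key //; case: eqP => [e1|]; last by rewrite mulr0.
by rewrite -e1 mq' in mq.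
Qed.

Lemma coef_taylor_homotopy M f T e0 : (set_mnm (cov g T) <= M)%MM -> apex M = Some e0 ->
  coef_at M (taylor_homotopy f) T = cone lt e0 (coef_at M f) T.
Proof.
move=> cM ap; rewrite /coef_at cM /taylor_homotopy raddf_sum /=.
under eq_bigr => e eT do rewrite mcoeff_sgn coef_homotopy_term // ap.
rewrite /cone; case: ifPn => e0T.
  rewrite (bigD1 e0) //= eqxx big1 ?addr0 => [|e /andP[_ ne]].
    by rewrite (lepm_trans (cov_sub_le (subsetDl _ _)) cM).
  by rewrite ifN ?mulr0 //; apply: contra ne => /eqP[->].
rewrite big1 // => e eT; rewrite ifN ?mulr0 //.
by apply: contraNneq e0T => -[->].
Qed.

(** In each multidegree where the complex is not zero, some generator divides, and
    coning with apex that generator contracts the simplex. *)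
Lemma taylor_exact f i :
  (forall T, T \subset E -> #|T| = i -> taylor_bnd f T = 0) ->
  forall T, T \subset E -> #|T| = i.+1 -> taylor_bnd (taylor_homotopy f) T = f T.
Proof.
move=> cyc T TE Ti; apply: coef_at_ext => M cM.
have TM : T \subset below M by rewrite below_sub TE.
have [e0 ap] : exists e0, apex M = Some e0.
  rewrite /apex; case: pickP => [e0|b0]; first by exists e0.
  have [e eT] : exists e, e \in T by apply/set0Pn; rewrite -card_gt0 Ti.
  by have := b0 e; rewrite (subsetP TM).
have e0M : e0 \in below M by move: ap; rewrite /apex; case: pickP => // e eM [<-].
rewrite coef_taylor_bnd //.
transitivity (bnd lt (below M) (cone lt e0 (coef_at M f)) T).
  apply: eq_bnd => e; rewrite inE => /andP[_]; rewrite inE => /andP[_ eM].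
  by apply: coef_taylor_homotopy => //; rewrite covU1 set_mnmU_le eM.
rewrite -[RHS](bnd_cone lt_tour (coef_at M f) T e0M) -[LHS]addr0; congr (_ + _).
rewrite /cone; case: ifP => // e0T.
have T'M : (set_mnm (cov g (T :\ e0)) <= M)%MM.
  by apply: lepm_trans cM; apply: cov_sub_le; apply: subsetDl.
rewrite -coef_taylor_bnd // /coef_at T'M cyc ?mcoeff0 ?mulr0 //.
  by apply: subset_trans TE; apply: subsetDl.
by move: Ti; rewrite (cardsD1 e0) e0T => -[].
Qed.

Definition in_taylor i T := (T \subset E) && (#|T| == i).
Definition taylor_set i (k : 'I_#|{: family_set (in_taylor i)}|) : {set I} := member k.

Lemma taylor_setP i (k : 'I_#|{: family_set (in_taylor i)}|) :
  taylor_set k \subset E /\ #|taylor_set k| = i.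
Proof. by have /andP[? /eqP] := memberP k. Qed.

Lemma taylor_surj i T : T \subset E -> #|T| = i ->
  exists k : 'I_#|{: family_set (in_taylor i)}|, taylor_set k = T.
Proof. by move=> TE Ti; apply: member_surj; rewrite /in_taylor TE Ti eqxx. Qed.

Definition taylor_mx i :
    'M[S]_(#|{: family_set (in_taylor i.+1)}|, #|{: family_set (in_taylor i)}|) :=
  \matrix_(k, j) \sum_(e in E :\: taylor_set j | e |: taylor_set j == taylor_set k)
     sgn S lt e (taylor_set j) * set_monomial (g e :\: cov g (taylor_set j)).

Definition taylor_complex : free_complex K N :=
  @FreeComplex K N (fun i => #|{: family_set (in_taylor i)}|)
    (fun i k => #|cov g (taylor_set k)|) taylor_mx (const_mx 1).

Lemma taylor_mx_sum i (R : comNzRingType) (phi : {rmorphism S -> R}) (f : {set I} -> R)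
    (j : 'I_#|{: family_set (in_taylor i)}|) :
  \sum_k f (taylor_set k) * phi (taylor_mx i k j) =
  \sum_(e in E :\: taylor_set j)
     sgn R lt e (taylor_set j) *
     (phi (set_monomial (g e :\: cov g (taylor_set j))) * f (e |: taylor_set j)).
Proof.
under eq_bigr => k _ do rewrite mxE raddf_sum mulr_sumr.
rewrite (exchange_big_dep (fun e => e \in E :\: taylor_set j)) /=; last by move=> k e _ /andP[].
apply: eq_bigr => e; rewrite inE => /andP[eT eE].
have [jE cj] := taylor_setP j.
have [||k kE] := @taylor_surj i.+1 (e |: taylor_set j).
- by rewrite subUset sub1set eE.
- by rewrite cardsU1 eT cj.
rewrite (big_pred1 k) ?kE => [|k']; last first.
  by rewrite inE eT eE /= -kE (inj_eq (@member_inj _ _)) eq_sym.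
by rewrite rmorphM mulrC -mulrA sgn_rmorph.
Qed.

Lemma taylor_row_mul i (v : 'rV_#|{: family_set (in_taylor i.+1)}|) j :
  (v *m taylor_mx i) 0 j = taylor_bnd (extend (v 0)) (taylor_set j).
Proof.
rewrite mxE -[RHS](taylor_mx_sum idfun); apply: eq_bigr => k _.
by rewrite extendE.
Qed.

Lemma taylor_graded : graded_complex taylor_complex.
Proof.
split=> [a|i k j m] /=.
  rewrite mxE; have [_ /cards0_eq ->] := taylor_setP a.
  by rewrite /cov big_set0 cards0; apply: dhomog1.
rewrite mxE => /[dup] mk.
have hom : \sum_(e in E :\: taylor_set j | e |: taylor_set j == taylor_set k)
     sgn S lt e (taylor_set j) * set_monomial (g e :\: cov g (taylor_set j))
     \is (#|cov g (taylor_set k)| - #|cov g (taylor_set j)|)%N.-homog.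
  apply: rpred_sum => e /andP[_ /eqP <-].
  have -> : (#|cov g (e |: taylor_set j)| - #|cov g (taylor_set j)|)%N =
      #|g e :\: cov g (taylor_set j)|.
    rewrite covU1 cardsU cardsD.
    by have := subset_leq_card (subsetIl (g e) (cov g (taylor_set j))); lia.
  rewrite -(sgn_rmorph _ (@mpolyC N K)) mul_mpolyC; apply: dhomogZ.
  by rewrite dhomogX /= mdeg_set_mnm.
move/(dhomog_mf hom) => /= ->; rewrite subnKC //.
have [e /andP[_ /eqP <-]|none] :=
    pickP (fun e => (e \in E :\: taylor_set j) && (e |: taylor_set j == taylor_set k)).
  by rewrite covU1 subset_leq_card // subsetUr.
by move: mk; rewrite big_pred0 ?msupp0.
Qed.

Lemma taylor_resolves : resolves taylor_complex monomial_ideal.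
Proof.
split=> [p|v|i v] /=.
- have [k kE] := taylor_surj (sub0set E) (cards0 I).
  exists (p *: delta_mx 0 k); rewrite -scalemxAl -rowE !mxE mulr1 subrr.
  by exists (fun=> 0); rewrite big1 // => e _; rewrite mul0r.
- have [k kE] := taylor_surj (sub0set E) (cards0 I).
  have k_all (k' : 'I_#|{: family_set (in_taylor 0)}|) : k' = k.
    apply: member_inj; have [_ /cards0_eq k'0] := taylor_setP k'.
    by rewrite -/(taylor_set k) -/(taylor_set k') kE.
  have -> : (v *m (const_mx 1 : 'cV_(_))) 0 0 = v 0 k.
    by rewrite mxE (bigD1 k) //= ?mxE mulr1 big1 ?addr0 // => k'; rewrite (k_all k') eqxx.
  have bndE f : taylor_bnd f (taylor_set k) = \sum_(e in E) f [set e] * set_monomial (g e).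
    rewrite kE /taylor_bnd setD0; apply: eq_bigr => e _.
    by rewrite /sgn big_set0 mul1r /cov big_set0 setD0 setU0 mulrC.
  split=> [[w wE]|[w wE]]; last first.
    by rewrite wE taylor_row_mul bndE; exists (fun e => extend (w 0) [set e]).
  exists (\row_j \sum_(e | [set e] == taylor_set j) w e).
  apply/rowP => k'; rewrite (k_all k') taylor_row_mul bndE wE.
  apply: eq_bigr => e eE; congr (_ * _).
  have [||j jE] := @taylor_surj 1 [set e]; rewrite ?sub1set ?cards1 //.
  rewrite -jE extendE mxE jE (big_pred1 e) // => e'; exact: (inj_eq set1_inj).
split=> [v0|[w ->]]; last first.
  apply/rowP => j; rewrite taylor_row_mul mxE.
  have [jE cj] := taylor_setP j.
  rewrite -[RHS](taylor_bnd_sq (extend (w 0)) jE); apply: eq_bigr => e; rewrite inE => /andP[eT eE].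
  have [||k kE] := @taylor_surj i.+1 (e |: taylor_set j).
  - by rewrite subUset sub1set eE.
  - by rewrite cardsU1 eT cj.
  by rewrite -kE extendE taylor_row_mul.
have cyc T : T \subset E -> #|T| = i -> taylor_bnd (extend (v 0)) T = 0.
  move=> TE Ti; have [j <-] := taylor_surj TE Ti.
  by rewrite -taylor_row_mul v0 mxE.
have ex := taylor_exact cyc.
exists (\row_k taylor_homotopy (extend (v 0)) (taylor_set k)).
apply/rowP => j; have [jE cj] := taylor_setP j.
rewrite -[LHS]extendE -/(taylor_set j) -ex // taylor_row_mul.
apply: eq_bigr => e; rewrite inE => /andP[eT eE].
have [||k kE] := @taylor_surj i.+2 (e |: taylor_set j).
- by rewrite subUset sub1set eE.
- by rewrite cardsU1 eT cj.
by rewrite -kE extendE mxE.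
Qed.

End Taylor.

(** * Betti numbers as homology of strands *)

Section Bridge.
Variables (K : fieldType) (V I : finType).
Variables (g : I -> {set V}) (E : {set I}).
Local Notation N := #|V|.
Local Notation S := {mpoly K[N]}.
Implicit Types (T : {set I}) (s : {set V}).

Section FixOrder.
Variable lt : rel I.
Hypothesis lt_tour : tournament lt.
Let G := taylor_complex K lt g E.

(** The coefficient of [e |: T] in the Taylor differential is a monomial of positive
    degree unless [g e] is already covered by [T]. *)
Lemma taylor_mod_max i (z : 'rV[K]_(rank G i.+1)) (j : 'I_(rank G i)) :
  (z *m mod_max (diff G i)) 0 j =
  bnd lt (inside g E (cov g (taylor_set j))) (extend (z 0)) (taylor_set j).
Proof.
rewrite mxE; transitivity
  (\sum_k extend (z 0) (taylor_set k) * mcoeff 0%MM (taylor_mx K lt g E i k j)).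
  by apply: eq_bigr => k _; rewrite extendE mxE.
rewrite (taylor_mx_sum _ _ (mcoeff 0%MM)) /bnd.
rewrite (bigID (fun e => g e \subset cov g (taylor_set j))) /= [X in _ + X]big1 ?addr0.
  apply: eq_big => [e|e /andP[_ sub]]; first by rewrite !inE andbA.
  congr (_ * _); rewrite mcoeffX set_mnm_eq0 (_ : _ :\: _ = set0) ?eqxx ?mul1r //.
  by apply/eqP; rewrite setD_eq0.
move=> e /andP[_ sub]; rewrite mcoeffX set_mnm_eq0 setD_eq0 (negPf sub) mul0r mulr0 //.
Qed.

(** The multigrading splits the reduced Taylor complex into strands. *)
Lemma tor_zero_exact i j : tor_zero G i j <-> forall s, #|s| = j -> exact_at K lt g E s i.
Proof.
have ext_in k (T : {set I}) e s : T \subset E -> #|T| = k ->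
  e \in inside g E s :\: T -> exists a : 'I_(rank G k.+1), taylor_set a = e |: T.
  move=> TE Tk; rewrite !inE => /andP[eT /andP[eE _]]; apply: taylor_surj.
    by rewrite subUset sub1set eE.
  by rewrite cardsU1 eT Tk.
have insE s T : T \subset inside g E s -> T \subset E.
  by move=> TA; apply: subset_trans TA _; apply/subsetP => e; rewrite inE => /andP[].
split=> [tz s sj f cyc|ex z zj zc].
  have [||u uE] := tz (\row_k if cov g (taylor_set k) == s then f (taylor_set k) else 0).
  - by move=> a aj; rewrite mxE; case: eqP => // cs; rewrite /= cs sj eqxx in aj.
  - case: i cyc {tz} => [//|i] cyc /=; apply/rowP => a; rewrite taylor_mod_max mxE.
    have [aE ai] := taylor_setP a.
    have [cs|cs] := eqVneq (cov g (taylor_set a)) s.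
      have aA : taylor_set a \subset inside g E s.
        apply/subsetP => e ea; rewrite inE (subsetP aE) //= -cs; exact: bigcup_sup.
      rewrite -[RHS](cyc _ aA) ?ai // cs; apply: eq_bnd => e eA.
      have [b bE] := ext_in _ _ _ _ aE ai eA; rewrite -bE extendE mxE bE.
      by move: eA; rewrite inE => /andP[_ eA]; rewrite (cov_insideU eA cs) eqxx.
    rewrite /bnd big1 // => e eA.
    have [b bE] := ext_in _ _ _ _ aE ai eA; rewrite -bE extendE mxE bE.
    move: eA; rewrite inE => /andP[_ eA].
    by rewrite (cov_insideU eA erefl) (negPf cs) mulr0.
  exists (extend (u 0)) => T TA Ti cT.
  have [k kT] := taylor_surj (insE _ _ TA) Ti.
  move/rowP/(_ k): uE; rewrite taylor_mod_max mxE.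
  by rewrite kT cT eqxx => ->.
have [u uP] : exists u : {set V} -> {set I} -> K, forall s T, T \subset inside g E s ->
    #|T| = i -> cov g T = s -> bnd lt (inside g E s) (u s) T = extend (z 0) T.
  apply: (functional_choice (P := fun s u => forall T, T \subset inside g E s ->
    #|T| = i -> cov g T = s -> bnd lt (inside g E s) u T = extend (z 0) T)) => s.
  have [sj|sj] := eqVneq #|s| j; last first.
    exists (fun=> 0) => T TA Ti cT; rewrite /bnd big1 => [|e _]; last by rewrite mulr0.
    have [k kT] := taylor_surj (insE _ _ TA) Ti.
    by rewrite -kT extendE zj //= kT cT.
  apply: (ex s sj) => T TA Ti cT.
  case: i z {ex zj} zc Ti => [//|i] z /= zc [Ti].
  have [k kT] := taylor_surj (insE _ _ TA) Ti.
  by have := taylor_mod_max z k; rewrite zc mxE kT cT.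
exists (\row_k u (cov g (taylor_set k)) (taylor_set k)).
apply/rowP => k; rewrite taylor_mod_max.
have [kE ki] := taylor_setP k.
rewrite -[LHS]extendE -/(taylor_set k) -(uP (cov g (taylor_set k))) //; last first.
  apply/subsetP => e ea; rewrite inE (subsetP kE) //=; exact: bigcup_sup.
apply: eq_bnd => e eA; have [b bE] := ext_in _ _ _ _ kE ki eA.
rewrite -bE extendE mxE bE; move: eA; rewrite inE => /andP[_ eA].
by rewrite (cov_insideU eA erefl).
Qed.

End FixOrder.

Variable P : S -> Prop.
Hypotheses (PE : forall p, P p <-> monomial_ideal g E p) (gE : forall e, e \in E -> g e != set0).

Let P0 : P 0.
Proof. by apply/PE; exists (fun=> 0); rewrite big1 // => e _; rewrite mul0r. Qed.

Let PL c p q : P p -> P q -> P (c * p + q).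
Proof.
move=> /PE[w ->] /PE[w' ->]; apply/PE; exists (fun e => c * w e + w' e).
rewrite mulr_sumr -big_split; apply: eq_bigr => e _ /=.
by rewrite mulrDl mulrA.
Qed.

Let Ph d p : P p -> P (pihomog mdeg d p).
Proof.
move=> /PE[w ->]; apply/PE.
exists (fun e => if (#|g e| <= d)%N then pihomog mdeg (d - #|g e|) (w e) else 0).
rewrite raddf_sum; apply: eq_bigr => e _ /=; rewrite (@pihomog_mul _ _ _ #|g e|).
  by case: ifP; rewrite ?mul0r.
by rewrite dhomogX /= mdeg_set_mnm.
Qed.

Let Pm p : P p -> p@_0%MM = 0.
Proof.
move=> /PE[w ->]; rewrite raddf_sum /= big1 // => e eE.
rewrite mulrC mcoeffXM ifN //; apply: contra (gE eE) => /set_mnm_le H.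
by rewrite -subset0; apply/subsetP => x /H; rewrite mnm0E.
Qed.

(** A minimal resolution and the Taylor resolution compute the same [Tor], and the
    latter decomposes into strands. *)
Lemma graded_betti_exact lt i j : tournament lt ->
  graded_betti P i j <> 0%N <-> exists2 s : {set V}, #|s| = j & ~ exact_at K lt g E s i.
Proof.
move=> lt_tour.
have FP : minimal_graded_resolution P (min_res P).
  apply: (epsilon_spec (inhabits (zero_complex K N))); exists (resolution P).
  exact: resolution_minimal.
have GP : graded_resolution P (taylor_complex K lt g E).
  split; first exact: taylor_graded.
  have [H1 H2 H3] := taylor_resolves K lt_tour g E; split=> //.
    by move=> p; have [v /PE Pv] := H1 p; exists v.
  by move=> v; rewrite -H2; apply: PE.
have -> : graded_betti P i j <> 0%N <-> exists a : 'I_(rank (min_res P) i), shift a = j.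
  rewrite /graded_betti; split=> [/eqP|[a aj] /cards0_eq/setP/(_ a)]; last by rewrite !inE aj eqxx.
  by rewrite cards_eq0 => /set0Pn[a]; rewrite inE => /eqP; exists a.
rewrite (minimal_shift_tor P0 PL Ph i j FP GP) tor_zero_exact.
split=> [H|[s sj ns] H]; last exact: ns (H s sj).
apply: NNPP => H'; apply: H => s sj; apply: NNPP => ns; apply: H'; by exists s.
Qed.

Definition reg_attained lt r := exists (s : {set V}) i, #|s| = (r + i)%N /\ ~ exact_at K lt g E s i.

Lemma regularity_unique r r' : is_regularity P r -> is_regularity P r' -> r = r'.
Proof.
move=> [[i [j [b ->]]] H] [[i' [j' [b' ->]]] H'].
by apply/eqP; rewrite eq_le H' // H.
Qed.

Lemma is_regularity_exact lt r : tournament lt -> reg_le K lt g E r -> reg_attained lt r ->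
  is_regularity P r%:Z.
Proof.
move=> lt_tour rE [s [i [si ns]]]; split=> [|i' j'].
  exists i, #|s|; split; last by rewrite si; lia.
  by apply/(graded_betti_exact _ _ lt_tour); exists s.
move/(graded_betti_exact _ _ lt_tour) => [s' sj ns'].
suff : (#|s'| <= r + i')%N by lia.
by rewrite leqNgt; apply/negP => /rE/ns'.
Qed.

Lemma regularity_eq lt r : tournament lt -> reg_le K lt g E r -> reg_attained lt r ->
  regularity P = r%:Z.
Proof.
move=> lt_tour rE ra; have H := is_regularity_exact lt_tour rE ra.
by apply: (regularity_unique _ H); apply: epsilon_spec; exists r%:Z.
Qed.

(** Betti numbers do not depend on the tournament chosen for the signs. *)
Lemma reg_le_order lt lt' r : tournament lt -> tournament lt' ->
  reg_le K lt g E r -> reg_le K lt' g E r.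
Proof.
move=> tour tour' rE s i ri; apply: NNPP => ns.
have /(graded_betti_exact _ _ tour)[s' ss' []] : graded_betti P i #|s| <> 0%N.
  by apply/(graded_betti_exact _ _ tour'); exists s.
by apply: rE; rewrite ss'.
Qed.

Lemma reg_attained_order lt lt' r : tournament lt -> tournament lt' ->
  reg_attained lt r -> reg_attained lt' r.
Proof.
move=> tour tour' [s [i [si ns]]].
have /(graded_betti_exact _ _ tour')[s' ss' ns'] : graded_betti P i #|s| <> 0%N.
  by apply/(graded_betti_exact _ _ tour); exists s.
by exists s', i; rewrite ss'.
Qed.

(** The strand of the empty set is not exact in degree 0, so the least bound is
    attained. *)
Lemma reg_exists lt : tournament lt -> exists2 r, reg_le K lt g E r & reg_attained lt r.
Proof.
move=> tour.
have ns0 : ~ exact_at K lt g E set0 0.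
  have A0 : inside g E set0 = set0.
    apply/setP => e; rewrite !inE subset0; apply/negbTE; rewrite negb_and.
    by case: (boolP (e \in E)) => // /gE.
  have := @not_exact_full K V I lt g E set0; rewrite /= A0 cards0; apply.
    by rewrite /cov big_set0.
  by move=> T; rewrite subset0 => /eqP.
have top : reg_le K lt g E #|V| by move=> s i; rewrite ltnNge (leq_trans (max_card _)) ?leq_addr.
have [r rle rmin] := ex_minimal (P := fun r => reg_le K lt g E r) top.
exists r => //; case: r rle rmin => [|r] rle rmin.
  by exists set0, 0%N; split; [exact: cards0|].
apply: NNPP => na; apply: (rmin r (ltnSn r)) => s i; rewrite leq_eqVlt => /orP[/eqP e|]; last first.
  by rewrite -addSn; apply: rle.
by apply: NNPP => ns; apply: na; exists s, i; rewrite -e addSn.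
Qed.

End Bridge.

(** * Strands of edge ideals *)

Lemma imset_subset (aT rT : finType) (f : aT -> rT) (A B : {set aT}) : injective f ->
  (f @: A \subset f @: B) = (A \subset B).
Proof.
move=> fI; apply/idP/idP => [/subsetP H|]; last exact: imsetS.
by apply/subsetP => x xA; have := H (f x); rewrite !mem_imset //; apply.
Qed.

Lemma sub_imsetP (aT rT : finType) (f : aT -> rT) (A : {set aT}) (B : {set rT}) :
  B \subset f @: A -> exists2 C : {set aT}, B = f @: C & C \subset A.
Proof.
move=> /subsetP BA; exists [set x in A | f x \in B].
  apply/setP => y; apply/idP/imsetP => [yB|[x]].
    by have /imsetP[x xA yx] := BA y yB; exists x; rewrite // inE xA -yx.
  by rewrite inE => /andP[_ ?] ->.
by apply/subsetP => x; rewrite inE => /andP[].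
Qed.

Section Relabel.
Variables (K : fieldType) (V V' I I' : finType) (lt : rel I').
Variables (vmap : V -> V') (phi : I -> I') (g : I -> {set V}) (g' : I' -> {set V'}).
Hypotheses (vmap_inj : injective vmap) (phi_inj : injective phi).
Hypothesis gE : forall e, g' (phi e) = vmap @: g e.
Definition pull_order : rel I := fun e e' => lt (phi e) (phi e').
Implicit Types (T : {set I}) (s : {set V}) (E A : {set I}).

Lemma pull_tournament : tournament lt -> tournament pull_order.
Proof. by move=> tour e e' ne; apply: tour; rewrite (inj_eq phi_inj). Qed.

Lemma inside_imset E s : inside g' (phi @: E) (vmap @: s) = phi @: inside g E s.
Proof.
apply/setP => y; rewrite inE; apply/andP/imsetP => [[/imsetP[e eE ->]]|[e]].
  by rewrite gE imset_subset // => es; exists e; rewrite // inE eE.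
by rewrite inE => /andP[eE es] ->; rewrite mem_imset // gE imset_subset.
Qed.

Lemma cov_imset T : cov g' (phi @: T) = vmap @: cov g T.
Proof.
apply/setP => y; apply/bigcupP/imsetP => [[_ /imsetP[e eT ->]]|[x /bigcupP[e eT xe] ->]].
  by rewrite gE => /imsetP[x xe ->]; exists x => //; apply/bigcupP; exists e.
by exists (phi e); rewrite ?mem_imset // gE mem_imset.
Qed.

Lemma bnd_imset A T (f : {set I'} -> K) :
  bnd lt (phi @: A) f (phi @: T) = bnd pull_order A (fun T => f (phi @: T)) T.
Proof.
rewrite /bnd.
have -> : phi @: A :\: phi @: T = phi @: (A :\: T).
  apply/setP => y; rewrite inE; apply/andP/imsetP => [[yT /imsetP[e eA yE]]|[e]].
    by exists e; rewrite // inE eA andbT; apply: contra yT; rewrite yE mem_imset.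
  by rewrite inE => /andP[eT eA] ->; rewrite !mem_imset.
rewrite big_imset /=; last by move=> e e' _ _; apply: phi_inj.
apply: eq_bigr => e _; rewrite imsetU1; congr (_ * _).
by rewrite /sgn big_imset //= => ? ? _ _; apply: phi_inj.
Qed.

Lemma relabel_exact E s i : exact_at K lt g' (phi @: E) (vmap @: s) i <->
  exact_at K pull_order g E s i.
Proof.
have cov_eq T : (cov g' (phi @: T) = vmap @: s) <-> cov g T = s.
  by rewrite cov_imset; split=> [/(imset_inj vmap_inj)|->].
split=> ex f cyc.
  have preK T : [set e | phi e \in phi @: T] = T by apply/setP => e; rewrite inE mem_imset.
  have [T'|u uP] := ex (fun T' : {set I'} => f [set e | phi e \in T']).
    rewrite inside_imset => /sub_imsetP[T -> TA]; rewrite card_imset // => Ti /cov_eq cT.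
    rewrite bnd_imset -[RHS](cyc T) //; apply: eq_bnd => e _; by rewrite preK.
  exists (fun T => u (phi @: T)) => T TA Ti cT.
  have := uP (phi @: T); rewrite inside_imset bnd_imset preK => -> //.
  - exact: imsetS.
  - by rewrite card_imset.
  - exact/cov_eq.
have [T TA Ti cT|u uP] := ex (fun T => f (phi @: T)).
  rewrite -bnd_imset -inside_imset; apply: cyc; rewrite ?inside_imset ?imsetS ?card_imset //.
  exact/cov_eq.
exists (fun T' : {set I'} => u [set e | phi e \in T']) => T'.
rewrite inside_imset => /sub_imsetP[T -> TA]; rewrite card_imset // => Ti /cov_eq cT.
rewrite bnd_imset -(uP T) //; apply: eq_bnd => e _; congr u.
by apply/setP => e'; rewrite inE mem_imset.
Qed.

Lemma relabel_reg_le E r : reg_le K pull_order g E r -> reg_le K lt g' (phi @: E) r.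
Proof.
move=> rE s' i ri; case: (boolP (s' \subset vmap @: setT)) => s'V.
  have [s sE _] := sub_imsetP s'V; rewrite sE in ri *.
  by apply/relabel_exact; apply: rE; rewrite -(card_imset s vmap_inj).
apply: exact_no_cover; apply: contraNneq s'V => <-.
apply/bigcupsP => e; rewrite inE => /andP[/imsetP[e0 _ ->] _].
by rewrite gE imsetS // subsetT.
Qed.
End Relabel.

Section Graphs.
Variable G : sgraph.
Implicit Types (x y : G) (D : {set G}).

Definition edges : {set {set G}} := [set [set x; y] | x in G, y in G & adj x y].

Definition isolated_vertices : {set G} := [set x | isolated x].

Definition edge_gens : {set {set G}} := edges :|: [set [set x] | x in isolated_vertices].

Definition nbhd x : {set G} := [set y | adj x y].

Definition avoid D : {set {set G}} := [set e in edges | [disjoint e & D]].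

Lemma edgesP e : reflect (exists x y, adj x y /\ e = [set x; y]) (e \in edges).
Proof.
apply: (iffP imset2P) => [[x y _]|[x [y [xy ->]]]].
  by rewrite inE => xy ->; exists x, y.
by exists x y; rewrite // inE.
Qed.

Lemma edge_gens_neq0 e : e \in edge_gens -> e != set0.
Proof.
rewrite inE => /orP[/edgesP[x [y [_ ->]]]|/imsetP[x _ ->]];
  by apply/set0Pn; exists x; rewrite !inE eqxx.
Qed.

Lemma edge_at x e : e \in edges -> x \in e -> exists2 y, adj x y & e = [set x; y].
Proof.
move=> /edgesP[a [b [ab ->]]]; rewrite !inE => /orP[/eqP ->|/eqP ->]; first by exists b.
by exists a; rewrite 1?adj_sym // setUC.
Qed.

Lemma adj_neq x y : adj x y -> x != y.
Proof. by apply: contraTneq => ->; rewrite adj_irrefl. Qed.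

Lemma set_monomial1 (K : fieldType) x : set_monomial K [set x] = vvar K x.
Proof.
rewrite /set_monomial /vvar; congr mpolyX; apply/mnmP => i; rewrite mnmE mnm1E inE.
by rewrite -(inj_eq enum_rank_inj) enum_valK eq_sym.
Qed.

Lemma set_monomial2 (K : fieldType) x y : x != y -> set_monomial K [set x; y] = vvar K x * vvar K y.
Proof.
move=> xy; rewrite -!set_monomial1 /set_monomial -mpolyXD -set_mnmD; congr ('X_[_ + _]).
by congr set_mnm; apply/setP => z; rewrite !inE; case: (eqVneq z x) => [->|_]; rewrite ?andbF // xy.
Qed.

Lemma edge_ideal_monomial (K : fieldType) p :
  edge_ideal p <-> monomial_ideal id edge_gens (p : {mpoly K[#|G|]}).
Proof.
split=> [[s [sg ->]]|[w ->]].
  have gen_mono q : edge_gen (K := K) (G := G) q ->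
      exists2 e, e \in edge_gens & q = set_monomial K e.
    move=> [[x [y [xy ->]]]|[x [xi ->]]].
      exists [set x; y]; last by rewrite set_monomial2 ?adj_neq.
      by rewrite inE; apply/orP; left; apply/edgesP; exists x, y.
    exists [set x]; last by rewrite set_monomial1.
    by rewrite inE; apply/orP; right; apply: imset_f; rewrite inE.
  elim: s sg => [|c s IH] sg.
    by exists (fun=> 0); rewrite big_nil big1 // => e _; rewrite mul0r.
  have [|w wE] := IH; first by move=> c' c's; apply: sg; rewrite inE c's orbT.
  have [e eG cE] := gen_mono _ (sg c (mem_head _ _)).
  exists (fun e' => w e' + (if e' == e then c.1 else 0)); rewrite big_cons wE cE addrC.
  under [RHS]eq_bigr => e' _ do rewrite mulrDl.
  rewrite big_split /=; congr (_ + _).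
  rewrite (bigD1 e) //= eqxx big1 ?addr0 // => e' /andP[_ /negPf ->].
  by rewrite mul0r.
exists [seq (w e, set_monomial K e) | e <- enum edge_gens]; split; last by rewrite big_map big_enum.
move=> c /mapP[e]; rewrite mem_enum inE => /orP[/edgesP[x [y [xy ->]]]|/imsetP[x xi ->]] ->.
  by left; exists x, y; rewrite set_monomial2 ?adj_neq.
by right; exists x; rewrite set_monomial1; move: xi; rewrite inE.
Qed.

Section Reg.
Variables (K : fieldType) (lt : rel {set G}).
Hypothesis tour : tournament lt.

(** The variables of the isolated vertices involve no edge, so adding them to the
    generators does not raise the regularity. *)
Lemma reg_le_edge_gens r : reg_le K lt id edges r -> reg_le K lt id edge_gens r.
Proof.
move=> rE; apply: (reg_le_singles tour (Y := isolated_vertices)).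
  move=> y yi; left; exists [set y] => //.
  by rewrite inE imset_f ?orbT.
congr reg_le: rE; apply/setP => e; rewrite !inE.
apply/idP/andP => [eE|[/orP[//|/imsetP[x xi ->]]]]; last by rewrite disjoints1 xi.
split; first by rewrite eE.
rewrite -setI_eq0; apply/eqP/setP => x; rewrite !inE; apply/negP => /andP[xe /forallP xi].
by have [y xy _] := edge_at eE xe; have := xi y; rewrite xy.
Qed.

(** If a strand at [s] is not exact then edges cover [s], which therefore contains no
    isolated vertex: the additional generators do not lie inside [s]. *)
Lemma not_exact_edge_gens s i : ~ exact_at K lt id edges s i -> ~ exact_at K lt id edge_gens s i.
Proof.
move=> ns ex; apply: (ns).
have cs : cov id (inside id edges s) = s.
  by apply/eqP; apply/negP => /negP cs; apply: ns; apply: exact_no_cover.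
apply: eq_exact_at ex => //; apply/setP => e; rewrite !inE.
case es : (e \subset s); rewrite ?andbF // !andbT.
apply/orP/idP => [[//|/imsetP[x]]|]; last by left.
rewrite inE => /forallP xi eE; move: es; rewrite eE sub1set -cs => /bigcupP[e' ].
rewrite inE => /andP[e'E _] xe'; have [y xy _] := edge_at e'E xe'.
by have := xi y; rewrite xy.
Qed.

(** Deleting [x], or deleting [x] and its neighbours: the ideal [I : x] contains the
    neighbours of [x] as variables, and modulo these only the edges avoiding [x] and
    its neighbours remain. *)
Lemma avoid_step D x r : x \notin D -> reg_le K lt id (avoid (x |: D)) r.+1 ->
  reg_le K lt id (avoid (D :|: nbhd x :|: [set x])) r -> reg_le K lt id (avoid D) r.+1.
Proof.
move=> xD rdel rlink; apply: (vertex_step tour (x := x)).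
  congr reg_le: rdel; apply/setP => e; rewrite !inE -andbA; congr (_ && _).
  by rewrite andbC -!setI_eq0 setIUr setU_eq0 !setI_eq0 disjoint_sym disjoints1.
suff rE : reg_le K lt (fun e => id e :\ x) (avoid D) r.
  by move=> s i; rewrite addSn => ri; apply: rE.
apply: (reg_le_singles tour (Y := nbhd x)).
  move=> y; rewrite inE => xy; case: (boolP (y \in D)) => yD.
    right=> e; rewrite inE => /andP[_ eD]; rewrite !inE negb_and orbC.
    by apply/orP; left; apply/negP => ye; rewrite (disjointFr eD ye) in yD.
  left; exists [set x; y].
    rewrite inE; apply/andP; split; first by apply/edgesP; exists x, y.
    by rewrite -setI_eq0 setIUl setU_eq0 !setI_eq0 !disjoints1 xD.
  apply/setP => z; rewrite !inE; case: eqP => [->|] //=.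
  by rewrite (negPf (adj_neq xy)).
have linkE : [set e in avoid D | [disjoint id e :\ x & nbhd x]] = avoid (D :|: nbhd x :|: [set x]).
  apply/setP => e; rewrite !inE -andbA; case eE: (e \in edges) => //=.
  rewrite -[in RHS]setI_eq0 !setIUr !setU_eq0 !setI_eq0 -andbA; congr (_ && _).
  apply/idP/andP => [dN|[dN dx]].
    have xe : x \notin e.
      apply/negP => xe; have [y xy eE'] := edge_at eE xe.
      have yN : y \in nbhd x by rewrite inE.
      have := disjointFl dN yN; rewrite eE' !inE eqxx orbT andbT.
      by rewrite eq_sym (adj_neq xy).
    have ex : [disjoint e & [set x]] by rewrite disjoint_sym disjoints1.
    by split=> //; move: dN; rewrite /= (setDidPl ex).
  by apply: disjointWl dN; apply: subsetDl.
rewrite linkE; apply: eq_reg_le rlink => e; rewrite inE => /andP[_ eD].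
apply/esym/setDidPl; apply: disjointWr eD; exact: subsetUr.
Qed.
End Reg.
End Graphs.

(** * Coronas *)

Section Independence.
Variable X : sgraph.
Implicit Types (A W : {set X}).

Definition independent A := [forall x in A, forall y in A, ~~ adj x y].

Lemma independentP A : reflect {in A &, forall x y, ~~ adj x y} (independent A).
Proof.
apply: (iffP forall_inP) => [H x y xA yA|H x xA]; first exact: (forall_inP (H x xA)).
by apply/forall_inP => y yA; apply: H.
Qed.

Definition alpha W : nat := \max_(A : {set X} | (A \subset W) && independent A) #|A|.

Lemma leq_alpha A W : A \subset W -> independent A -> (#|A| <= alpha W)%N.
Proof. by move=> AW iA; apply: (leq_bigmax_cond (F := fun A => #|A|)); rewrite AW. Qed.

Lemma alpha_attained W : exists A, [/\ A \subset W, independent A & #|A| = alpha W].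
Proof.
have P0 : (set0 \subset W) && independent set0.
  by rewrite sub0set; apply/independentP => x; rewrite inE.
rewrite /alpha (bigop.bigmax_eq_arg set0 P0); case: arg_maxnP => // A /andP[AW iA] _.
by exists A.
Qed.

Lemma alphaS W W' : W \subset W' -> (alpha W <= alpha W')%N.
Proof.
move=> WW'; have [A [AW iA <-]] := alpha_attained W.
by apply: leq_alpha; rewrite // (subset_trans AW).
Qed.

Lemma alpha_link W x : x \in W -> (alpha ((W :\: nbhd x) :\ x) < alpha W)%N.
Proof.
move=> xW; have [A [AW iA <-]] := alpha_attained ((W :\: nbhd x) :\ x).
have AP y : y \in A -> [/\ y != x, ~~ adj x y & y \in W].
  by move/(subsetP AW); rewrite !inE => /and3P[].
have xA : x \notin A by apply/negP => /AP[]; rewrite eqxx.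
have -> : #|A|.+1 = #|x |: A| by rewrite cardsU1 xA.
apply: leq_alpha.
  by rewrite subUset sub1set xW; apply/subsetP => y /AP[].
apply/independentP => a b; rewrite !inE => /orP[/eqP ->|aA] /orP[/eqP ->|bA].
- by rewrite adj_irrefl.
- by have [] := AP b bA.
- by rewrite adj_sym; have [] := AP a aA.
by move/independentP: iA; apply.
Qed.
End Independence.

Section Corona.
Variables (K : fieldType) (X H : sgraph).
Hypothesis H_gt0 : (0 < #|H|)%N.
Let C := corona X H.
Variable lt : rel {set C}.
Hypothesis tour : tournament lt.
Implicit Types (x y : X) (W U A : {set X}).

Definition base x : C := inl x.
Definition copy x (h : H) : C := inr (x, h).

Lemma copy_inj x : injective (copy x).
Proof. by move=> h k []. Qed.

Lemma corona_edge_gens : edge_gens C = edges C.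
Proof.
rewrite /edge_gens (_ : isolated_vertices C = set0) ?imset0 ?setU0 //.
apply/setP => v; rewrite !inE; apply/negbTE/forallPn.
have [h _] := card_gt0P H_gt0.
by case: v => [x|[x k]]; [exists (inr (x, h))|exists (inl x)]; rewrite /= negbK eqxx.
Qed.

(** [W] is the set of surviving vertices of [X], and [U] that of the vertices whose
    copy of [H] survives. *)
Definition dead W U : {set C} :=
  [set v | match v with inl x => x \notin W | inr (x, _) => x \notin U end].

(** Applying the deletion step to the vertices of [X] one by one: deleting [base x]
    changes only [W], while deleting [base x] with its neighbours also removes the
    copy of [H] at [x]. A bound [mu] valid when no vertex of [X] survives is thus
    valid always, provided that it does not increase in the first case and drops in
    the second. *)
Lemma corona_reg_le (mu : {set X} -> {set X} -> nat) :
  (forall U, reg_le K lt id (avoid (dead set0 U)) (mu set0 U)) ->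
  (forall x W U, x \in W -> x \in U -> (mu (W :\ x) U <= mu W U)%N /\
     (mu ((W :\: nbhd x) :\ x) (U :\ x) < mu W U)%N) ->
  forall W U, W \subset U -> reg_le K lt id (avoid (dead W U)) (mu W U).
Proof.
move=> mu0 muS W; have [m] := ubnP #|W|; elim: m W => // m IH W Wm U WU.
have [->|[x xW]] := set_0Vmem W; first exact: mu0.
have xU := subsetP WU _ xW; have [mu1 mu2] := muS x W U xW xU.
have Wx : (#|W :\ x| < m)%N by move: Wm; rewrite (cardsD1 x) xW.
have del : dead (W :\ x) U = base x |: dead W U.
  by apply/setP => -[y|[y h]]; rewrite !inE //= negb_and negbK.
have link : dead ((W :\: nbhd x) :\ x) (U :\ x) = dead W U :|: nbhd (base x) :|: [set base x].
  have eq_base y : ((inl y : C) == base x) = (y == x) by [].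
  have eq_leaf y h : ((inr (y, h) : C) == base x) = false by [].
  apply/setP => -[y|[y h]]; rewrite !inE ?eq_base ?eq_leaf /= ?orbF.
    by rewrite !negb_and !negbK orbC [_ || adj x y]orbC.
  by rewrite negb_and negbK orbC [x == y]eq_sym.
case: (mu W U) mu1 mu2 => // k mu1 mu2; apply: (avoid_step tour (x := base x)).
- by rewrite inE /= negbK.
- rewrite -del; apply: reg_leW mu1 _; apply: IH => //.
  by apply: subset_trans WU; apply: subsetDl.
rewrite -link; apply: (reg_leW (r := mu ((W :\: nbhd x) :\ x) (U :\ x))); first by rewrite -ltnS.
apply: IH.
  by apply: leq_ltn_trans Wx; apply/subset_leq_card/setSD/subsetDl.
apply/subsetP => y; rewrite !inE => /and3P[-> _ /(subsetP WU) //].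
Qed.

Lemma avoid_dead0 : avoid (dead setT setT) = edges C.
Proof.
apply/setP => e; rewrite inE (_ : dead _ _ = set0) -?setI_eq0 ?setI0 ?eqxx ?andbT //.
by apply/setP => -[x|[x h]]; rewrite !inE.
Qed.

Lemma null_base U : null_graph H -> avoid (dead set0 U) = set0.
Proof.
move=> /forallP nullH; apply/setP => e; rewrite !inE; apply/negbTE/negP.
move=> /andP[/edgesP[u [v [uv ->]]] dd].
have notl (x : X) : (inl x : C) \in [set u; v] -> False.
  by move=> xe; have := disjointFr dd xe; rewrite !inE.
case: u v uv {dd} notl => [x|[x h]] [y|[y k]] /=.
- by move=> _ /(_ x); rewrite !inE eqxx; apply.
- by move=> _ /(_ x); rewrite !inE eqxx; apply.
- by move=> _ /(_ y); rewrite !inE eqxx orbT; apply.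
by case/andP => _ hk; have /forallP/(_ k) := nullH h; rewrite hk.
Qed.

Lemma reg_le_set0 (V I : finType) (lt' : rel I) (g : I -> {set V}) r : reg_le K lt' g set0 r.
Proof.
move=> s i ri; apply: exact_no_cover; rewrite (_ : inside g set0 s = set0); last first.
  by apply/setP => e; rewrite !inE.
rewrite /cov big_set0 eq_sym -card_gt0; by apply: leq_ltn_trans ri.
Qed.

Lemma null_reg_le : null_graph H -> reg_le K lt id (edges C) (alpha [set: X]).
Proof.
move=> nullH; rewrite -avoid_dead0.
apply: (corona_reg_le (mu := fun W _ => alpha W)) => [U|x W U xW _|//].
  by rewrite null_base //; apply: reg_le_set0.
by split; [apply/alphaS/subsetDl|apply: alpha_link].
Qed.

(** The leaves attached to an independent set [A] form an induced matching. The strand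
    of its vertex set consists of the whole matching only. *)
Lemma null_attained : null_graph H -> reg_attained K id (edges C) lt (alpha [set: X]).
Proof.
move=> nullH; have [A [_ iA <-]] := alpha_attained [set: X].
have [h _] := card_gt0P H_gt0.
pose leaf x : {set C} := [set base x; copy x h].
have leaf_inj : injective leaf.
  by move=> x y /setP/(_ (base x)); rewrite !inE eqxx /= orbF => /esym/eqP[].
pose s : {set C} := \bigcup_(x in A) leaf x.
have sl x : (base x \in s) = (x \in A).
  apply/bigcupP/idP => [[y yA]|xA]; last by exists x; rewrite // !inE eqxx.
  by rewrite !inE orbF => /eqP[->].
have sr x k : (copy x k \in s) = (x \in A) && (k == h).
  apply/bigcupP/andP => [[y yA]|[xA /eqP ->]]; last by exists x; rewrite // !inE eqxx orbT.
  by rewrite !inE /= => /eqP[-> ->].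
(* Independence of [A] excludes edges between base vertices, and the absence of edges
   in [H] those inside a copy. *)
have insE : inside id (edges C) s = leaf @: A.
  apply/setP => e; rewrite inE; apply/andP/imsetP => [[eE es]|[x xA ->]]; last first.
    split; last exact: bigcup_sup.
    by apply/edgesP; exists (base x), (copy x h); split=> //=.
  have [u [v [uv eE']]] := edgesP _ eE.
  have us : u \in s by apply: (subsetP es); rewrite eE' !inE eqxx.
  have vs : v \in s by apply: (subsetP es); rewrite eE' !inE eqxx orbT.
  case: u v uv us vs {eE es} eE' => [x|[x k]] [y|[y l]] /= uv;
    rewrite ?(sl x) ?(sl y) ?(sr x k) ?(sr y l).
  - by move=> xA yA; move/independentP: iA => /(_ x y xA yA); rewrite uv.
  - by move=> xA /andP[_ /eqP ->] ->; exists x; rewrite // (eqP uv).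
  - by move=> /andP[xA /eqP ->] _ ->; exists x; rewrite // (eqP uv) setUC.
  by case/andP: uv => _ kl; have /forallP/(_ l) := forallP nullH k; rewrite kl.
have cov_sub_leaf (T : {set X}) : cov id (leaf @: T) = \bigcup_(x in T) leaf x.
  by rewrite /cov (big_imset _ (in2W leaf_inj)).
exists s, #|A|; split.
  have -> : s = base @: A :|: copy^~ h @: A.
    apply/setP => -[x|[x k]]; rewrite in_setU ?(sl x) ?(sr x k).
      have nb : (inl x : C) \notin copy^~ h @: A by apply/imsetP => -[].
      by rewrite (negPf nb) orbF; apply/esym/(@mem_imset X C base A x) => ? ? [].
    apply/andP/orP => [[xA /eqP ->]|[/imsetP[]//|/imsetP[y yA [-> ->]]//]].
    by right; apply/imsetP; exists x.
  rewrite cardsU !card_imset; [|by move=> ? ? []|by move=> ? ? []].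
  rewrite (_ : _ :&: _ = set0) ?cards0 ?subn0 //.
  by apply/setP => v; rewrite !inE; apply/negbTE/andP => -[/imsetP[x _ ->] /imsetP[]].
rewrite -(card_imset A leaf_inj) -insE; apply: not_exact_full.
  by rewrite insE cov_sub_leaf.
move=> T TA cT; apply/eqP; rewrite eqEsubset TA insE; apply/subsetP => _ /imsetP[x xA ->].
have : copy x h \in cov id T by rewrite cT sr xA eqxx.
case/bigcupP => e eT; move: (subsetP TA e eT); rewrite insE => /imsetP[y yA eE].
by move: eT; rewrite eE !inE /= => ? /eqP[->].
Qed.

Definition copy_edges x : {set {set C}} := [set copy x @: e | e : {set H} in edges H].
Definition copies U : {set {set C}} := \bigcup_(x in U) copy_edges x.
Definition copy_support U : {set C} := [set v | if v is inr (x, _) then x \in U else false].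

Lemma copies1 x U : x \notin U -> copies (x |: U) = copy_edges x :|: copies U.
Proof. by move=> xU; rewrite /copies big_setU1. Qed.

Lemma copy_edges_sub x e : e \in copy_edges x -> e \subset copy_support [set x].
Proof.
by move=> /imsetP[e0 _ ->]; apply/subsetP => _ /imsetP[h _ ->]; rewrite inE /= set11.
Qed.

Lemma copies_sub U e : e \in copies U -> e \subset copy_support U.
Proof.
case/bigcupP => x xU /copy_edges_sub ex; apply: subset_trans ex _.
by apply/subsetP => -[y|[y h]]; rewrite !inE // => /eqP ->.
Qed.

Lemma copies_edges U : copies U = [set e in edges C | e \subset copy_support U].
Proof.
apply/setP => e; rewrite inE; apply/idP/andP => [eU|[/edgesP[u [v [uv ->]]]]].
  split; last exact: copies_sub.
  have /bigcupP[x xU /imsetP[e0 /edgesP[h [k [hk ->]]] ->]] := eU.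
  apply/edgesP; exists (copy x h), (copy x k); split; first by rewrite /= eqxx.
  by rewrite imsetU1 imset_set1.
rewrite subUset !sub1set !inE.
case: u v uv => [x|[x h]] [y|[y k]] //=; rewrite ?andbF // => /andP[/eqP <- hk] /andP[xU _].
apply/bigcupP; exists x => //; apply/imsetP; exists [set h; k].
  by apply/edgesP; exists h, k.
by rewrite imsetU1 imset_set1.
Qed.

Lemma avoid_copies U : avoid (dead set0 U) = copies U.
Proof.
rewrite copies_edges; apply/setP => e; rewrite !inE; congr (_ && _).
rewrite disjoints_subset (_ : ~: dead set0 U = copy_support U) //.
by apply/setP => -[x|[x h]]; rewrite !inE ?negbK.
Qed.

Let copy_disjoint x U : x \notin U -> [disjoint copy_edges x & copies U] /\
  [disjoint copy_support [set x] & copy_support U].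
Proof.
move=> xU; have dV : [disjoint copy_support [set x] & copy_support U].
  rewrite -setI_eq0; apply/eqP/setP => -[y|[y h]]; rewrite !inE //.
  by apply/negbTE; apply: contra xU => /andP[/eqP <-].
split=> //; rewrite -setI_eq0; apply/eqP/setP => e; rewrite !inE; apply/negbTE/negP.
move=> /andP[ex /copies_sub eU]; have /imsetP[e0 /edgesP[h [k [_ e0E]]] eE] := ex.
have he : copy x h \in e by rewrite eE mem_imset ?e0E ?inE ?eqxx //; apply: copy_inj.
by have := subsetP eU _ he; rewrite inE /= (negPf xU).
Qed.

(** Kunneth for one copy of [H] and the remaining ones. The copies inherit different
    tournaments from [lt], which is why the bound is assumed for all of them. *)
Lemma copies_reg_le r U :
  (forall lt', tournament lt' -> reg_le K lt' id (edges H) r) ->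
  reg_le K lt id (copies U) (#|U| * r).
Proof.
move=> rH; have [m] := ubnP #|U|; elim: m U => // m IH U Um.
have [->|[x xU]] := set_0Vmem U; first by rewrite /copies big_set0; apply: reg_le_set0.
have xU' : x \notin U :\ x by rewrite !inE eqxx.
have [dE dV] := copy_disjoint xU'.
rewrite -(setD1K xU) copies1 // cardsU1 xU' mulSn.
apply: (kunneth_reg_le tour (@copy_edges_sub x) (@copies_sub (U :\ x)) dE dV).
  have phi_inj := imset_inj (@copy_inj x).
  apply: (@relabel_reg_le K H C {set H} {set C} lt (copy x) (fun e => copy x @: e) id id) => //.
  - exact: copy_inj.
  - by apply: rH; apply: pull_tournament.
by apply: IH; move: Um; rewrite (cardsD1 x) xU.
Qed.

Lemma copies_attained r U :
  (forall lt', tournament lt' -> reg_attained K id (edges H) lt' r) ->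
  exists (s : {set C}) i, [/\ s \subset copy_support U, #|s| = (#|U| * r + i)%N &
    ~ exact_at K lt id (copies U) s i].
Proof.
move=> rH; have [m] := ubnP #|U|; elim: m U => // m IH U Um.
have [->|[x xU]] := set_0Vmem U.
  exists set0, 0%N; split; rewrite ?sub0set ?cards0 //.
  have A0 : inside id (copies set0) set0 = set0.
    by rewrite /copies big_set0; apply/setP => e; rewrite !inE.
  have := @not_exact_full K _ _ lt id (copies set0) set0; rewrite /= A0 cards0; apply.
    by rewrite /cov big_set0.
  by move=> T; rewrite subset0 => /eqP.
have xU' : x \notin U :\ x by rewrite !inE eqxx.
have [dE dV] := copy_disjoint xU'.
have [|s' [i' [s'U s'c ns']]] := IH (U :\ x); first by move: Um; rewrite (cardsD1 x) xU.
have phi_inj := imset_inj (@copy_inj x).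
have [s [i [si ns]]] := rH _ (pull_tournament phi_inj tour).
have sx : copy x @: s \subset copy_support [set x].
  by apply/subsetP => _ /imsetP[h _ ->]; rewrite inE /= set11.
rewrite -(setD1K xU) copies1 // cardsU1 xU' mulSn.
exists (copy x @: s :|: s'), (i + i')%N; split.
- apply/subsetP => v; rewrite inE => /orP[/(subsetP sx)|/(subsetP s'U)];
    by case: v => [y|[y h]]; rewrite !inE // => ->; rewrite ?orbT.
- rewrite addnACA -s'c -si -(card_imset s (@copy_inj x)); apply/eqP; rewrite leq_card_setU.
  by apply: disjointWl sx (disjointWr s'U dV).
apply: (kunneth_not_exact tour (@copy_edges_sub x) (@copies_sub (U :\ x)) dE dV) => //.
by move/(@relabel_exact K H C {set H} {set C} lt (copy x) (fun e => copy x @: e) id id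
  (@copy_inj x) phi_inj (fun=> erefl)).
Qed.

(** Losing the copy of [H] at [x] lowers the bound by [r], which absorbs the increment
    1 of the deletion step as [r] is positive. *)
Lemma nonnull_reg_le r : (0 < r)%N ->
  (forall lt', tournament lt' -> reg_le K lt' id (edges H) r) ->
  reg_le K lt id (edges C) (#|X| * r).
Proof.
move=> r0 rH; rewrite -avoid_dead0 -cardsT.
apply: (corona_reg_le (mu := fun _ U => (#|U| * r)%N)) => [U|x W U _ xU|//].
  by rewrite avoid_copies; apply: copies_reg_le.
by rewrite leqnn ltn_pmul2r // [X in (_ < X)%N](cardsD1 x) xU.
Qed.

(** A strand supported on the copies of [H] involves no other generators of the edge
    ideal of the corona. *)
Lemma nonnull_attained r :
  (forall lt', tournament lt' -> reg_attained K id (edges H) lt' r) ->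
  reg_attained K id (edges C) lt (#|X| * r).
Proof.
move=> rH; have [s [i [sU sc ns]]] := copies_attained [set: X] rH.
exists s, i; rewrite -cardsT; split=> // ex; apply: ns; apply: eq_exact_at ex => //.
apply/setP => e; rewrite !inE copies_edges !inE.
case es: (e \subset s); rewrite ?andbF // !andbT.
by rewrite (subset_trans es sU) andbT.
Qed.

End Corona.

Section Main.
Variable K : fieldType.

Definition enum_order (I : finType) : rel I := fun e e' => (enum_rank e < enum_rank e')%N.

Lemma enum_order_tournament (I : finType) : tournament (@enum_order I).
Proof.
move=> e e' ne; rewrite /enum_order -leqNgt ltn_neqAle.
by rewrite (inj_eq val_inj) (inj_eq enum_rank_inj) ne.
Qed.

(** The strand at the two ends of an edge consists of that edge alone. *)
Lemma edges_reg_gt0 (H : sgraph) lt r : ~~ null_graph H -> reg_le K lt id (edges H) r -> (0 < r)%N.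
Proof.
move=> /forallPn[h /forallPn[k]]; rewrite negbK => hk.
case: r => // rE; have ehk : [set h; k] \in edges H by apply/edgesP; exists h, k.
have hkne := adj_neq hk.
have A1 : inside id (edges H) [set h; k] = [set [set h; k]].
  apply/setP => e; rewrite !inE; apply/andP/eqP => [[eE es]|-> //].
  have [a [b [ab eE']]] := edgesP _ eE.
  by apply/eqP; rewrite eqEcard es eE' !cards2 hkne (adj_neq ab).
have cE (T : {set {set H}}) : T \subset [set [set h; k]] -> cov id T = [set h; k] ->
    T = [set [set h; k]].
  rewrite subset1 => /orP[/eqP //|/eqP ->]; rewrite /cov big_set0 => /setP/(_ h).
  by rewrite !inE eqxx.
have := @not_exact_full K _ _ lt id (edges H) [set h; k]; rewrite /= A1 cards1.
case=> //; first by rewrite /cov big_set1.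
by apply: rE; rewrite cards2 hkne.
Qed.

Lemma regularity_edge_ideal (H : sgraph) : exists r,
  [/\ regularity (@edge_ideal K H) = r%:Z,
      forall lt, tournament lt -> reg_le K lt id (edges H) r
    & forall lt, tournament lt -> reg_attained K id (edges H) lt r].
Proof.
have gE e : e \in edges H -> id e != set0.
  by move=> eE; apply: edge_gens_neq0; rewrite inE eE.
have PE (p : {mpoly K[#|H|]}) :
  monomial_ideal id (edges H) p <-> monomial_ideal id (edges H) p by [].
pose lt := @enum_order {set H}; have tour : tournament lt := @enum_order_tournament _.
have [r rE ra] := reg_exists K gE tour.
exists r; split=> [|lt' tour'|lt' tour'].
- apply: (regularity_eq (@edge_ideal_monomial H K) (@edge_gens_neq0 H) tour).
    exact: reg_le_edge_gens.
  by have [s [i [si ns]]] := ra; exists s, i; split=> //; apply: not_exact_edge_gens.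
- exact: (reg_le_order PE gE tour tour' rE).
exact: (reg_attained_order PE gE tour tour' ra).
Qed.

Lemma regularity_corona (X H : sgraph) : (0 < #|H|)%N ->
  regularity (@edge_ideal K (corona X H)) =
    if null_graph H then (alpha [set: X])%:Z
    else #|X|%:Z * regularity (@edge_ideal K H).
Proof.
move=> H_gt0; pose C := corona X H.
pose lt := @enum_order {set C}; have tour : tournament lt := @enum_order_tournament _.
have reg_eq r : reg_le K lt id (edges C) r -> reg_attained K id (edges C) lt r ->
    regularity (@edge_ideal K C) = r%:Z.
  rewrite -corona_edge_gens // => rE ra.
  exact: (regularity_eq (@edge_ideal_monomial C K) (@edge_gens_neq0 C) tour).
case: ifPn => nullH.
  by apply: reg_eq; [apply: null_reg_le|apply: null_attained].
have [r [-> rE ra]] := regularity_edge_ideal H.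
rewrite -PoszM; apply: reg_eq; last exact: nonnull_attained.
apply: nonnull_reg_le => //; exact: edges_reg_gt0 (rE _ (@enum_order_tournament _)).
Qed.
End Main.

(** An independent set is disjoint from its rotation by one step, so it has at most
    half of the vertices. The vertices [0, 2, ..., 2 (n./2 - 1)] are independent; when
    [n] is odd the last of them is [n - 3], hence not adjacent to [0]. *)
Lemma alpha_cycle n : (3 <= n)%N -> alpha [set: cycle_graph n] = n./2.
Proof.
move=> n3; have n0 : (0 < n)%N by apply: leq_trans n3.
have ordS_inj : injective (@ordS n) := can_inj (@ordSK n).
have ordS_neq (i : 'I_n) : i != ordS i.
  apply/eqP => /(congr1 val) /=; have [lt|ge] := ltnP i.+1 n; first by rewrite modn_small //; lia.
  have -> : i.+1 = n by apply/eqP; rewrite eqn_leq ge ltn_ord.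
  by rewrite modnn; move: ge; lia.
apply/eqP; rewrite eqn_leq; apply/andP; split.
  have [A [_ /independentP iA <-]] := alpha_attained [set: cycle_graph n].
  have dA : [disjoint (A : {set 'I_n}) & [set ordS i | i in (A : {set 'I_n})]].
    rewrite -setI_eq0; apply/eqP/setP => j; rewrite !inE; apply/negbTE/negP.
    move=> /andP[jA /imsetP[i iA' jE]]; have := iA i j iA' jA.
    by rewrite /= /cycle_adj jE ordS_neq eqxx.
  have : (#|(A : {set 'I_n}) :|: [set ordS i | i in (A : {set 'I_n})]| <= n)%N.
    by rewrite -[X in (_ <= X)%N]card_ord max_card.
  have -> : #|(A : {set 'I_n}) :|: [set ordS i | i in (A : {set 'I_n})]| =
      (#|(A : {set 'I_n})| + #|(A : {set 'I_n})|)%N.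
    rewrite -[X in _ = (_ + X)%N](card_imset _ ordS_inj).
    by apply/eqP; rewrite leq_card_setU.
  by rewrite addnn => /half_leq; rewrite doubleK.
have lt2 (i : 'I_n./2) : (i.*2 < n)%N.
  by have := ltn_ord i; lia.
pose f (i : 'I_n./2) : cycle_graph n := Ordinal (lt2 i).
have f_inj : injective f by move=> i j /(congr1 val) /= /double_inj/val_inj.
rewrite -[X in (X <= _)%N]card_ord -(card_imset _ f_inj); apply: leq_alpha; first exact: subsetT.
have fS (i j : 'I_n./2) : (f i : 'I_n) != ordS (f j).
  apply/eqP => /(congr1 val) /=; rewrite modn_small; last by have := ltn_ord j; lia.
  by lia.
apply/independentP => _ _ /imsetP[i _ ->] /imsetP[j _ ->] /=.
by rewrite /cycle_adj !(negPf (fS _ _)) andbF.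
Qed.

Theorem theorem2p30 (K : fieldType) (n : nat) (H : sgraph)
    (hn : (3 <= n)%N) (hH : (0 < #|H|)%N) :
  regularity (@edge_ideal K (corona (cycle_graph n) H)) =
    if null_graph H then (uphalf n.-1)%:Z
    else n%:Z * regularity (@edge_ideal K H).
Proof.
rewrite regularity_corona // alpha_cycle // card_ord.
by case: n hn => // n _; rewrite uphalfE.
Qed.
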